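(* Every instance of cluster aggregation with a nonempty portal set on an edge-weighted tree has a $4$-distortion solution, and such a solution can be computed in polynomial time.
   Context: An instance of cluster aggregation consists of an edge-weighted graph $G=(V,E,w)$, a partition $\mathcal C$ of $V$ into clusters of strong diameter at most $\Delta$ (i.e. each induced subgraph $G[C]$, $C\in\mathcal C$, has diameter at most $\Delta$ in its own shortest-path metric), and a set of portals $P\subseteq V$. A $\beta$-distortion solution is an assignment $f:\mathcal C\to P$ such that for every $v\in V$ $$d_{G[f^{-1}(f(v))]}(v,f(v))\le d_G(v,P)+\beta\cdot\Delta,$$ where $f(v):=f(C_v)$ with $C_v\in\mathcal C$ the cluster containing $v$, and $f^{-1}(p):=\{v\in V:f(v)=p\}$. Here $d_G$ is shortest-path distance and $d_G(v,P)=\min_{p\in P}d_G(v,p)$. *)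

(* Defs.v *)
From Corelib Require Import BinNums.
From mathcomp Require Import all_boot all_order all_algebra.
From mathcomp Require Import constructive_ereal.

Set Implicit Arguments.
Unset Strict Implicit.
Unset Printing Implicit Defensive.

Import Order.TTheory GRing.Theory Num.Theory.
Local Open Scope ring_scope.

(* Finite simple undirected graphs; [weight u v] is irrelevant off the edges. *)
Record wgraph (R : realFieldType) (V : finType) := WGraph {
  edge : rel V;
  weight : V -> V -> R;
  edge_sym : symmetric edge;
  edge_irr : irreflexive edge;
  weight_sym : forall u v, edge u v -> weight u v = weight v u;
  weight_ge0 : forall u v, edge u v -> 0 <= weight u v
}.

Section Graph.
Variables (R : realFieldType) (V : finType) (G : wgraph R V).
Implicit Types (A : {set V}) (u v : V) (s : seq V).

Definition is_tree : Prop :=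
  (forall u v, connect (edge G) u v) /\
  (forall s, (2 < size s)%N -> ~~ ucycleb (edge G) s).

(* [u :: s] is a simple path from u to v in the induced subgraph G[A]. *)
Definition simple_path A u v s : bool :=
  [&& path (edge G) u s, last u s == v, uniq (u :: s) & all (mem A) (u :: s)].

Definition path_length u s : R := \sum_(x <- pairmap (weight G) u s) x.

(* d_{G[A]}(u, v), which is +oo if u and v are not connected in G[A]; simple
   paths suffice as weights are nonnegative, and have at most #|V| vertices. *)
Definition dist A u v : \bar R :=
  \big[Order.min/+oo%E]_(s : #|V|.-bseq V | simple_path A u v s)
    (path_length u s)%:E.

Definition dist_to_set u A : \bar R :=
  \big[Order.min/+oo%E]_(p in A) dist setT u p.

Definition strong_diam A : \bar R :=
  \big[Order.max/-oo%E]_(u in A) \big[Order.max/-oo%E]_(v in A) dist A u v.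

End Graph.

Record instance (R : realFieldType) (V : finType) := Instance {
  graph : wgraph R V;
  clusters : {set {set V}};
  Delta : R;
  portals : {set V};
  clusters_partition : partition clusters [set: V];
  clusters_diam :
    forall C, C \in clusters -> (strong_diam graph C <= Delta%:E)%E
}.

Section Solution.
Variables (R : realFieldType) (V : finType) (I : instance R V).

(* An assignment is a function on all sets of vertices, of which only the
   values on the clusters matter. *)
Definition portal_of (f : {set V} -> V) (v : V) : V := f (pblock (clusters I) v).

Definition served (f : {set V} -> V) (p : V) : {set V} :=
  [set v | portal_of f v == p].

Definition is_solution (beta : R) (f : {set V} -> V) : Prop :=
  (forall C, C \in clusters I -> f C \in portals I) /\
  (forall v,
     (dist (graph I) (served f (portal_of f v)) v (portal_of f v)
      <= dist_to_set (graph I) v (portals I) + (beta * Delta I)%:E)%E).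

End Solution.

(* The machine model is a first-order functional language over binary trees in
   the style of N. D. Jones (Computability and Complexity, MIT Press, 1997). Each
   elementary step is a constant number of pointer operations on shared tree
   cells, so for outputs of polynomial size, as below, polynomial time here is
   polynomial time on Turing machines. *)
Inductive data : Type := Nil | Cons of data & data.

Fixpoint data_size (d : data) : nat :=
  if d is Cons a b then (data_size a + data_size b).+1 else 1%N.

Definition hd d := if d is Cons a _ then a else Nil.
Definition tl d := if d is Cons _ b then b else Nil.

(* Each function has a single argument, denoted by [EArg] in its body. *)
Inductive expr : Type :=
| EArg
| ENil
| ECons of expr & expr
| EHd of expr
| ETl of expr
| EIf of expr & expr & expr
| ECall of nat & expr.

(* The bodies of the mutually recursive functions; the entry point is the
   function of index 0. *)
Definition program := seq expr.

(* [eval P x e v t]: with argument x, expression e has value v, by call by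
   value, in t elementary steps. In a conditional, [Nil] is false and every
   other tree is true. *)
Inductive eval (P : program) : data -> expr -> data -> nat -> Prop :=
| EvalArg x : eval P x EArg x 1
| EvalNil x : eval P x ENil Nil 1
| EvalCons x e1 e2 v1 v2 t1 t2 :
    eval P x e1 v1 t1 -> eval P x e2 v2 t2 ->
    eval P x (ECons e1 e2) (Cons v1 v2) (t1 + t2).+1
| EvalHd x e v t : eval P x e v t -> eval P x (EHd e) (hd v) t.+1
| EvalTl x e v t : eval P x e v t -> eval P x (ETl e) (tl v) t.+1
| EvalIfTrue x e e1 e2 a b v t t1 :
    eval P x e (Cons a b) t -> eval P x e1 v t1 ->
    eval P x (EIf e e1 e2) v (t + t1).+1
| EvalIfFalse x e e1 e2 v t t2 :
    eval P x e Nil t -> eval P x e2 v t2 ->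
    eval P x (EIf e e1 e2) v (t + t2).+1
| EvalCall x k e body y v t t' :
    eval P x e y t -> onth P k = Some body -> eval P y body v t' ->
    eval P x (ECall k e) v (t + t').+1.

Definition computes_in (P : program) (x y : data) (t : nat) : Prop :=
  eval P x (ECall 0 EArg) y t.

Lemma eval_det P x e v v' t t' :
  eval P x e v t -> eval P x e v' t' -> v = v' /\ t = t'.
Proof.
move=> H; elim: H v' t' => {x e v t}.
- by move=> x v' t' H; inversion H.
- by move=> x v' t' H; inversion H.
- move=> x e1 e2 v1 v2 t1 t2 _ IH1 _ IH2 v' t' H; inversion H; subst.
  by have [-> ->] := IH1 _ _ ltac:(eassumption);
     have [-> ->] := IH2 _ _ ltac:(eassumption).
- move=> x e v t _ IH v' t' H; inversion H; subst.
  by have [-> ->] := IH _ _ ltac:(eassumption).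
- move=> x e v t _ IH v' t' H; inversion H; subst.
  by have [-> ->] := IH _ _ ltac:(eassumption).
- move=> x e e1 e2 a b v t t1 _ IH _ IH1 v' t' H; inversion H; subst;
    have [E ->] := IH _ _ ltac:(eassumption) => //.
  by have [-> ->] := IH1 _ _ ltac:(eassumption).
- move=> x e e1 e2 v t t2 _ IH _ IH2 v' t' H; inversion H; subst;
    have [E ->] := IH _ _ ltac:(eassumption) => //.
  by have [-> ->] := IH2 _ _ ltac:(eassumption).
- move=> x k e body y v t u _ IH Hb _ IH' v' t' H.
  inversion H as [| | | | | | |? ? ? body' y' ? s s' He Hb' Hbody]; subst.
  have [? ->] := IH _ _ He; subst y'.
  move: Hb'; rewrite Hb => -[?]; subst body'.
  by have [-> ->] := IH' _ _ Hbody.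
Qed.

Definition enc_bool (b : bool) : data := if b then Cons Nil Nil else Nil.

Definition enc_seq (T : Type) (enc : T -> data) (s : seq T) : data :=
  foldr (fun a d => Cons (enc a) d) Nil s.

Definition enc_option (T : Type) (enc : T -> data) (o : option T) : data :=
  if o is Some a then Cons (enc a) Nil else Nil.

(* Binary digits, least significant first; 0 has no digits. *)
Fixpoint pos_digits (p : positive) : seq bool :=
  match p with
  | xH => [:: true]
  | xO q => false :: pos_digits q
  | xI q => true :: pos_digits q
  end.

Definition digits (n : nat) : seq bool :=
  if bin_of_nat n is Npos p then pos_digits p else [::].

Definition enc_nat (n : nat) : data := enc_seq enc_bool (digits n).

Definition enc_int (z : int) : data := Cons (enc_bool (z < 0)) (enc_nat `|z|%N).

Definition enc_rat (q : rat) : data := Cons (enc_int (numq q)) (enc_int (denq q)).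

Section Encoding.
Variable n : nat.

Definition enc_set (A : {set 'I_n}) : data :=
  enc_seq (fun i => enc_bool (i \in A)) (enum 'I_n).

(* The weighted adjacency matrix, row by row. *)
Definition enc_graph (G : wgraph rat 'I_n) : data :=
  enc_seq
    (fun i => enc_seq
       (fun j => enc_option enc_rat (if edge G i j then Some (weight G i j) else None))
       (enum 'I_n))
    (enum 'I_n).

Definition enc_instance (I : instance rat 'I_n) : data :=
  Cons (enc_graph (graph I))
    (Cons (enc_seq enc_set (enum (clusters I)))
      (Cons (enc_rat (Delta I)) (enc_set (portals I)))).

(* The portal of each cluster, with clusters in the order of [enc_instance]. *)
Definition enc_assignment (I : instance rat 'I_n) (f : {set 'I_n} -> 'I_n) : data :=
  enc_seq (fun C => enc_nat (f C)) (enum (clusters I)).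

End Encoding.

(* One program returns, on the encoding of every rational instance satisfying
   [cond], the encoding of a beta-distortion solution, in time polynomial in
   the size of the encoding. *)
Definition solvable_in_polynomial_time (beta : rat)
    (cond : forall n, instance rat 'I_n -> Prop) : Prop :=
  exists (P : program) (c k : nat),
    forall (n : nat) (I : instance rat 'I_n), cond n I ->
    exists (f : {set 'I_n} -> 'I_n) (t : nat),
      [/\ is_solution I beta f,
          computes_in P (enc_instance I) (enc_assignment I f) t &
          (t <= c * data_size (enc_instance I) ^ k)%N].

(* Main.v *)
(** Fix a root and consider the vertex of each cluster closest to the root (its
    top).  Call a top t good if some portal below t is, up to 2 Delta, as close to
    t as any portal at all; the root is good since Delta >= 0.  A vertex v is
    served by the portal nearest to a(v) among those below a(v), where a(v) is the
    last good top on the path from the root to v.  Only tops matter for a(v), so v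
    and its cluster are served alike, and the set of vertices served by a portal
    contains the paths to it.  If t is a top, q its nearest portal and u the vertex
    where the paths from the root to t and q separate, then either q is not below
    a(t), and goodness of a(t) loses at most 2 Delta; or the top of the cluster of
    u is good, hence a(t) is within Delta of u and detouring through a(t) loses
    2 Delta; or that top is not good, which contradicts the choice of q.  Passing
    from t to the other vertices of its cluster loses another 2 Delta.

    The complexity bound comes from a calculus of polynomial-time terms: maps on
    encoded data that are closed under composition, branching and list recursion
    with polynomially bounded intermediate values.  Tree paths are found by rounds
    of breadth-first search towards their end, and distances are compared as sums
    of fractions in binary. *)

From Corelib Require Import BinNums.
Require Import Defs.
From mathcomp Require Import all_boot all_order all_algebra.
From mathcomp Require Import constructive_ereal.
From mathcomp Require Import zify lra ring.
Import Defs.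

Set Implicit Arguments.
Unset Strict Implicit.
Unset Printing Implicit Defensive.

Import Order.TTheory GRing.Theory Num.Theory.

(** * Polynomial-time maps on encoded data *)

(** Functions are called by position, so placing a program behind [k] other functions requires
    adding [k] to each call index. *)
Fixpoint shift (k : nat) (e : expr) : expr :=
  match e with
  | EArg => EArg
  | ENil => ENil
  | ECons a b => ECons (shift k a) (shift k b)
  | EHd a => EHd (shift k a)
  | ETl a => ETl (shift k a)
  | EIf a b c => EIf (shift k a) (shift k b) (shift k c)
  | ECall j a => ECall (k + j) (shift k a)
  end.

Lemma shift0 e : shift 0 e = e.
Proof. by elim: e => //= [? -> ? ->|? ->|? ->|? -> ? -> ? ->|? ? ->]. Qed.

Lemma onth_reloc (Q P Q' : program) k body : onth P k = Some body ->
  onth (Q ++ map (shift (size Q)) P ++ Q') (size Q + k) = Some (shift (size Q) body).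
Proof.
move=> E; have kP : k < size P by rewrite -onthTE E.
by rewrite onth_cat ltnNge leq_addr addKn onth_cat size_map kP onth_map E.
Qed.

Lemma eval_reloc Q P Q' x e v t : eval P x e v t ->
  eval (Q ++ map (shift (size Q)) P ++ Q') x (shift (size Q) e) v t.
Proof.
elim=> {x e v t} /=; try by move=> *; econstructor; eauto.
move=> x k e body y v t t' _ IH Pk _ IH'.
by econstructor; [exact: IH|exact: onth_reloc Pk|exact: IH'].
Qed.

Lemma eval_extend P Q x e v t : eval P x e v t -> eval (P ++ Q) x e v t.
Proof.
move=> /(@eval_reloc [::] P Q) /=; rewrite shift0 (eq_map shift0) map_id.
by [].
Qed.

Local Notation sz := data_size.

Lemma sz_gt0 d : 0 < sz d. Proof. by case: d. Qed.

(** * Polynomial bounds in the size of the encoded input *)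

Definition pbounded (X : Type) (i : X -> data) (g : X -> nat) : Prop :=
  exists c, forall x, g x <= (sz (i x)).+1 ^ c.

Section PolynomialBounds.
Variables (X : Type) (i : X -> data).
Implicit Types g h : X -> nat.

Lemma pb_le g h : (forall x, g x <= h x) -> pbounded i h -> pbounded i g.
Proof. by move=> le [c H]; exists c => x; apply: leq_trans (le x) (H x). Qed.

Lemma pb_const n : pbounded i (fun=> n).
Proof.
exists n => x; apply: (@leq_trans (2 ^ n)); first exact/ltnW/ltn_expl.
by case: n => // n; rewrite leq_exp2r ?ltnS ?sz_gt0.
Qed.

Lemma pb_size : pbounded i (fun x => sz (i x)).
Proof. by exists 1 => x; rewrite expn1. Qed.

Lemma pb_add g h : pbounded i g -> pbounded i h -> pbounded i (fun x => g x + h x).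
Proof.
(* The base [(sz (i x)).+1] is at least 2, so the doubling in a sum of two powers costs one more
   factor of the base. *)
move=> [c H] [c' H']; exists (maxn c c').+1 => x.
have s2 : 1 < (sz (i x)).+1 by rewrite ltnS sz_gt0.
have le1 := leq_trans (H x) (leq_pexp2l (ltnW s2) (leq_maxl c c')).
have le2 := leq_trans (H' x) (leq_pexp2l (ltnW s2) (leq_maxr c c')).
apply: leq_trans (leq_add le1 le2) _; rewrite addnn -mul2n expnS.
by rewrite leq_mul2r s2 orbT.
Qed.

Lemma pb_mul g h : pbounded i g -> pbounded i h -> pbounded i (fun x => g x * h x).
Proof.
by move=> [c H] [c' H']; exists (c + c') => x; rewrite expnD leq_mul.
Qed.

Lemma pb_exp c g : pbounded i g -> pbounded i (fun x => g x ^ c).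
Proof.
move=> gb; elim: c => [|c IH]; first by apply: pb_le (pb_const 1) => x; rewrite expn0.
by apply: pb_le (pb_mul gb IH) => x; rewrite expnS.
Qed.

End PolynomialBounds.

Lemma pb_comp X (i j : X -> data) g :
  pbounded i (fun x => sz (j x)) -> pbounded j g -> pbounded i g.
Proof.
move=> ij [c H]; apply: (pb_le H); apply: pb_exp.
by apply: pb_le (pb_add (pb_const i 1) ij) => x; rewrite add1n.
Qed.

Definition runs (P : program) (X : Type) (i o : X -> data) (e : expr) (g : X -> nat) :=
  forall x, exists2 m, m <= g x & eval P (i x) e (o x) m.

Lemma runs_reloc Q P Q' X (i o : X -> data) e g : runs P i o e g ->
  runs (Q ++ map (shift (size Q)) P ++ Q') i o (shift (size Q) e) g.
Proof. by move=> H x; have [m le ev] := H x; exists m => //; apply: eval_reloc. Qed.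

Lemma runs_extend P Q X (i o : X -> data) e g : runs P i o e g -> runs (P ++ Q) i o e g.
Proof. by move=> H x; have [m le ev] := H x; exists m => //; apply: eval_extend. Qed.

(* Output sizes are bounded separately from running times because sharing
   allows outputs whose size is exponential in the running time. *)
Definition polytime (X : Type) (i o : X -> data) : Prop :=
  exists P e g, [/\ runs P i o e g, pbounded i g & pbounded i (fun x => sz (o x))].

(** Constructs with several arguments need them evaluated in one program: the second program is
    appended to the first with its calls shifted. *)
Lemma polytime_join X (i o : X -> data) Y (j k : Y -> data) :
  polytime i o -> polytime j k ->
  exists P e g e' h, [/\ runs P i o e g, pbounded i g, runs P j k e' h & pbounded j h].
Proof.
move=> [P [e [g [r gb _]]]] [Q [e' [h [r' hb _]]]].
exists (P ++ map (shift (size P)) Q), e, g, (shift (size P) e'), h; split=> //.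
  exact: runs_extend.
by have := runs_reloc P [::] r'; rewrite cats0.
Qed.

Lemma polytime_join3 X (i o : X -> data) Y (j k : Y -> data) Z (l m : Z -> data) :
  polytime i o -> polytime j k -> polytime l m ->
  exists P e1 g1 e2 g2 e3 g3, [/\ runs P i o e1 g1 /\ pbounded i g1,
    runs P j k e2 g2 /\ pbounded j g2 & runs P l m e3 g3 /\ pbounded l g3].
Proof.
move=> p1 p2 [Q [e3 [g3 [r3 b3 _]]]].
have [P [e1 [g1 [e2 [g2 [r1 b1 r2 b2]]]]]] := polytime_join p1 p2.
exists (P ++ map (shift (size P)) Q), e1, g1, e2, g2, (shift (size P) e3), g3.
split; split=> //; try exact: runs_extend.
by have := runs_reloc P [::] r3; rewrite cats0.
Qed.

Lemma polytime_bounded X (i o : X -> data) : polytime i o -> pbounded i (fun x => sz (o x)).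
Proof. by case=> P [e [g []]]. Qed.

(** * Closure under data constructors, branching and composition *)

Section Closure.
Variables (X : Type) (i : X -> data).
Implicit Types o : X -> data.

Lemma polytime_eq o o' : (forall x, o x = o' x) -> polytime i o -> polytime i o'.
Proof.
move=> E [P [e [g [r gb ob]]]]; exists P, e, g; split=> //.
  by move=> x; rewrite -E; apply: r.
by apply: pb_le ob => x; rewrite E.
Qed.

Lemma polytime_id : polytime i i.
Proof.
exists [::], EArg, (fun=> 1); split; [|exact: pb_const|exact: pb_size].
by move=> x; exists 1 => //; constructor.
Qed.

Lemma polytime_nil : polytime i (fun=> Nil).
Proof.
exists [::], ENil, (fun=> 1); split; [|exact: pb_const|exact: pb_const].
by move=> x; exists 1 => //; constructor.
Qed.

Lemma polytime_cons o o' : polytime i o -> polytime i o' -> polytime i (fun x => Cons (o x) (o' x)).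
Proof.
move=> po po'; have [P [e [g [e' [h [r gb r' hb]]]]]] := polytime_join po po'.
exists P, (ECons e e'), (fun x => 1 + (g x + h x)); split.
- move=> x; have [m le ev] := r x; have [m' le' ev'] := r' x.
  by exists (m + m').+1; [lia|constructor].
- exact: pb_add (pb_const _ _) (pb_add gb hb).
- apply: (@pb_le _ _ _ (fun x => 1 + (sz (o x) + sz (o' x)))) => [x /=|]; first by lia.
  by apply: pb_add (pb_const _ _) (pb_add _ _); apply: polytime_bounded.
Qed.

Lemma polytime_const d : polytime i (fun=> d).
Proof. by elim: d => [|a pa b pb]; [exact: polytime_nil|exact: polytime_cons]. Qed.

Lemma polytime_hd o : polytime i o -> polytime i (fun x => hd (o x)).
Proof.
move=> [P [e [g [r gb ob]]]]; exists P, (EHd e), (fun x => 1 + g x); split.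
- by move=> x; have [m le ev] := r x; exists m.+1; [lia|constructor].
- exact: pb_add (pb_const _ _) gb.
- by apply: pb_le ob => x; case: (o x) => //= a b; lia.
Qed.

Lemma polytime_tl o : polytime i o -> polytime i (fun x => tl (o x)).
Proof.
move=> [P [e [g [r gb ob]]]]; exists P, (ETl e), (fun x => 1 + g x); split.
- by move=> x; have [m le ev] := r x; exists m.+1; [lia|constructor].
- exact: pb_add (pb_const _ _) gb.
- by apply: pb_le ob => x; case: (o x) => //= a b; lia.
Qed.

Lemma polytime_if o o1 o2 : polytime i o -> polytime i o1 -> polytime i o2 ->
  polytime i (fun x => if o x is Cons _ _ then o1 x else o2 x).
Proof.
move=> po po1 po2.
have [P [e [g [e1 [g1 [e2 [g2 [[r gb] [r1 gb1] [r2 gb2]]]]]]]]] := polytime_join3 po po1 po2.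
exists P, (EIf e e1 e2), (fun x => 1 + (g x + (g1 x + g2 x))); split.
- move=> x; have [m le ev] := r x; have [m1 le1 ev1] := r1 x.
  have [m2 le2 ev2] := r2 x; case E: (o x) ev => [|a b] ev.
    by exists (m + m2).+1; [lia|apply: EvalIfFalse].
  by exists (m + m1).+1; [lia|apply: EvalIfTrue ev _].
- exact: pb_add (pb_const _ _) (pb_add gb (pb_add gb1 gb2)).
- apply: (@pb_le _ _ _ (fun x => sz (o1 x) + sz (o2 x))) => [x /=|]; first by case: (o x) => *; lia.
  by apply: pb_add; apply: polytime_bounded.
Qed.

End Closure.

(** A function sees a single argument, so composition is a call: [e'] becomes a new function,
    applied to the value of [e]. Its running time is polynomial in the size of [j x], which is
    polynomial in that of [i x]. *)
Lemma polytime_comp X (i j k : X -> data) : polytime i j -> polytime j k -> polytime i k.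
Proof.
move=> pij pjk; have [P [e [g [e' [h [r gb r' hb]]]]]] := polytime_join pij pjk.
have jb := polytime_bounded pij; have kb := polytime_bounded pjk.
exists (P ++ [:: e']), (ECall (size P) e), (fun x => 1 + (g x + h x)); split.
- move=> x; have [m le ev] := r x; have [m' le' ev'] := r' x.
  exists (m + m').+1; first by lia.
  apply: EvalCall (eval_extend _ ev) _ (eval_extend _ ev').
  by rewrite onth_cat ltnn subnn.
- exact: pb_add (pb_const _ _) (pb_add gb (pb_comp jb hb)).
- exact: pb_comp jb kb.
Qed.

Lemma polytime_reindex X Y (h : Y -> X) (i o : X -> data) :
  polytime i o -> polytime (fun y => i (h y)) (fun y => o (h y)).
Proof.
move=> [P [e [g [r [c gb] [c' ob]]]]]; exists P, e, (fun y => g (h y)); split.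
- by move=> y; apply: r.
- by exists c => y.
- by exists c' => y.
Qed.

(* A context [i : X -> data] describes how the values of the free variables of
   a term are laid out; [ext i eB] adds a variable of type [B x]. *)
Definition ext X (i : X -> data) (B : X -> Type) (eB : forall x, B x -> data) :
    {x : X & B x} -> data :=
  fun y => Cons (i (projT1 y)) (eB (projT1 y) (projT2 y)).

Section Contexts.
Variables (X : Type) (i : X -> data) (B : X -> Type) (eB : forall x, B x -> data).

Lemma polytime_weak o : polytime i o -> polytime (ext i eB) (fun y => o (projT1 y)).
Proof.
move=> /(polytime_reindex (fun y : {x : X & B x} => projT1 y)).
by apply: polytime_comp; apply: polytime_hd (polytime_id (ext i eB)).
Qed.

Lemma polytime_var : polytime (ext i eB) (fun y => eB (projT2 y)).
Proof. exact: polytime_tl (polytime_id (ext i eB)). Qed.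

End Contexts.

Lemma sz_enc_seq_size T (e : T -> data) s : size s < sz (enc_seq e s).
Proof. by elim: s => //= a s IH; rewrite ltnS; apply: leq_trans IH (leq_addl _ _). Qed.

Lemma sz_enc_seq_le T (e : T -> data) s M :
  (forall n a, onth s n = Some a -> sz (e a) <= M) -> sz (enc_seq e s) <= (size s * M.+1).+1.
Proof.
elim: s => //= a s IH H; have /= := H 0 a erefl; have := IH (fun n => H n.+1); lia.
Qed.

Lemma sz_enc_seq_cat T (e : T -> data) s1 s2 : sz (enc_seq e s2) <= sz (enc_seq e (s1 ++ s2)).
Proof. by elim: s1 => //= a s IH; lia. Qed.

Lemma sz_enc_seq_mem T (e : T -> data) s1 a s2 :
  sz (e a) < sz (enc_seq e (s1 ++ a :: s2)).
Proof. by elim: s1 => [|b s IH] /=; lia. Qed.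

(** * Recursion over lists *)

Section Fold.
Variables (X : Type) (i : X -> data) (B S : X -> Type).
Variables (eB : forall x, B x -> data) (eS : forall x, S x -> data).
Variables (l : forall x, seq (B x)) (z : forall x, S x).
Variables (f : forall x, B x -> S x -> S x).

(** The argument pairs the context with the remaining list. Function [N] is the step, its argument
    laid out as in [ext (ext i eB) eS]; [N.+1] is the initial value and [N.+2] is this loop
    itself. *)
Definition fold_body (N : nat) : expr :=
  EIf (ETl EArg)
    (ECall N (ECons (ECons (EHd EArg) (EHd (ETl EArg)))
                    (ECall N.+2 (ECons (EHd EArg) (ETl (ETl EArg))))))
    (ECall N.+1 (EHd EArg)).

(** The bound [gf] is asked only of the steps that occur in the run. The constants 10 and 20 are
    generous allowances for the fixed overhead of the end of the loop and of each round. *)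
Lemma fold_body_eval P N ef ez x gz gf s :
  onth P N = Some ef -> onth P N.+1 = Some ez -> onth P N.+2 = Some (fold_body N) ->
  (exists2 m, m <= gz & eval P (i x) ez (eS (z x)) m) ->
  (forall s1 b s2, s = s1 ++ b :: s2 -> let s' := foldr (@f x) (z x) s2 in
    exists2 m, m <= gf & eval P (Cons (Cons (i x) (eB b)) (eS s')) ef (eS (f b s')) m) ->
  exists2 m, m <= gz + 10 + size s * (gf + 20) &
    eval P (Cons (i x) (enc_seq (@eB x) s)) (fold_body N) (eS (foldr (@f x) (z x) s)) m.
Proof.
move=> PN PN1 PN2 [mz lez evz]; elim: s => [|b s IH] step /=.
  exists (2 + (2 + mz).+1).+1; first by lia.
  apply: EvalIfFalse; first exact: (EvalTl (EvalArg _ _)).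
  by apply: EvalCall PN1 evz; apply: (EvalHd (EvalArg _ _)).
have [m le ev] := IH (fun s1 b' s2 E => step (b :: s1) b' s2 (congr1 (cons b) E)).
have [mf lef evf] := step [::] b s erefl.
set a := Cons (i x) _.
have EA := EvalArg P a; have EH := EvalHd EA; have ET := EvalTl EA.
have ETT := EvalTl ET; have EHT := EvalHd ET.
have EC := EvalCall (EvalCons EH ETT) PN2 ev.
have EF := EvalCall (EvalCons (EvalCons EH EHT) EC) PN evf.
have EI := EvalIfTrue _ ET EF.
by eexists; last exact: EI; lia.
Qed.

(** Iterating a polynomial-time step may blow up the state exponentially, so a polynomial bound
    [bnd] on all intermediate results is assumed. It bounds the argument of each step, hence its
    time, and the number of steps is at most the size of the list. *)
Lemma polytime_foldr (bnd : X -> nat) :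
  polytime i (fun x => enc_seq (@eB x) (l x)) ->
  polytime i (fun x => eS (z x)) ->
  polytime (ext (ext i eB) (fun y => @eS (projT1 y)))
    (fun y => eS (f (projT2 (projT1 y)) (projT2 y))) ->
  pbounded i bnd ->
  (forall x l1 l2, l x = l1 ++ l2 -> sz (eS (foldr (@f x) (z x) l2)) <= bnd x) ->
  polytime i (fun x => eS (foldr (@f x) (z x) (l x))).
Proof.
move=> pl pz pf bb bndP; have lb := polytime_bounded pl.
have [P [ef [gf [ez [gz [el [gl [[rf [c gfb]] [rz gzb] [rl glb]]]]]]]]] :=
  polytime_join3 pf pz pl.
pose N := size P; pose Q := P ++ [:: ef; ez; fold_body N].
(* The 3 counts the two [Cons] cells in the argument of the step and the successor in [pbounded]. *)
pose T x := (sz (i x) + sz (enc_seq (@eB x) (l x)) + bnd x + 3) ^ c.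
exists Q, (ECall N.+2 (ECons EArg el)),
  (fun x => (gl x + 3) + (gz x + 10 + sz (enc_seq (@eB x) (l x)) * (T x + 20))); split.
- move=> x; have [ml lel evl] := rl x; have [mz lez evz] := rz x.
  have oQ k : onth Q (N + k) = onth [:: ef; ez; fold_body N] k.
    by rewrite onth_cat ltnNge leq_addr addKn.
  have [|||||m le ev] := @fold_body_eval Q N ef ez x (gz x) (T x) (l x).
  + by rewrite -[N]addn0 oQ.
  + by rewrite -addn1 oQ.
  + by rewrite -addn2 oQ.
  + by exists mz => //; apply: eval_extend.
  + move=> s1 b s2 E /=; pose s' := foldr (@f x) (z x) s2.
    have [m le ev] := rf (existT _ (existT _ x b) s').
    exists m; last exact: eval_extend.
    apply: leq_trans le _; apply: leq_trans (gfb _) _; rewrite /T /ext /=.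
    have := sz_enc_seq_mem (@eB x) s1 b s2; rewrite -E => bl.
    have : sz (eS s') <= bnd x by apply: (bndP x (rcons s1 b)); rewrite cat_rcons.
    case: (c) => // c' sb; rewrite leq_exp2r //; lia.
  + have EF := EvalCall (EvalCons (EvalArg Q (i x)) (eval_extend _ evl)) _ ev.
    eexists; last by apply: EF; rewrite -addn2 oQ.
    have := sz_enc_seq_size (@eB x) (l x).
    by move: lel le; clear; nia.
- have Tb : pbounded i T.
    by apply: pb_exp; do !apply: pb_add => //; [exact: pb_size|exact: pb_const].
  apply: pb_add; first by apply: pb_add => //; apply: pb_const.
  apply: pb_add; first by apply: pb_add => //; apply: pb_const.
  by apply: pb_mul => //; apply: pb_add => //; apply: pb_const.
- by apply: pb_le bb => x; apply: (bndP x [::]).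
Qed.

(** If each step adds to the measure an amount that does not depend on the state, the total growth
    is at most the number of steps times a polynomial. The measure may differ from the size because
    the size can grow in a state-dependent way, as when an addition turns many zero digits into
    ones. *)
Lemma polytime_foldr_additive (mu : forall x, S x -> nat) (g : forall x, B x -> nat) :
  polytime i (fun x => enc_seq (@eB x) (l x)) ->
  polytime i (fun x => eS (z x)) ->
  polytime (ext (ext i eB) (fun y => @eS (projT1 y)))
    (fun y => eS (f (projT2 (projT1 y)) (projT2 y))) ->
  (forall x s, sz (@eS x s) <= mu x s) ->
  (forall x b s, mu x (f b s) <= mu x s + g x b) ->
  pbounded i (fun x => mu x (z x)) ->
  pbounded (ext i eB) (fun y => g (projT1 y) (projT2 y)) ->
  polytime i (fun x => eS (foldr (@f x) (z x) (l x))).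
Proof.
move=> pl pz pf szmu muf zb [c gb]; have lb := polytime_bounded pl.
pose L x := sz (enc_seq (@eB x) (l x)).
pose T x := (sz (i x) + L x + 2) ^ c.
apply: (@polytime_foldr (fun x => mu x (z x) + L x * T x)) => //.
  apply: pb_add => //; apply: pb_mul => //; apply: pb_exp.
  by apply: pb_add; [apply: pb_add => //; apply: pb_size|exact: pb_const].
move=> x l1 l2 E; apply: leq_trans (szmu _ _) _.
suff H : mu x (foldr (@f x) (z x) l2) <= mu x (z x) + size l2 * T x.
  apply: leq_trans H _; rewrite leq_add2l leq_mul2r; apply/orP; right.
  apply: leq_trans (ltnW (sz_enc_seq_size (@eB x) l2)) _.
  by rewrite /L E sz_enc_seq_cat.
elim: l2 l1 E => [|b l2 IH] l1 E /=; first by rewrite addn0.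
have := IH (rcons l1 b); rewrite cat_rcons => /(_ E) le.
apply: leq_trans (muf _ _ _) _; rewrite mulSn addnCA addnC leq_add //.
apply: leq_trans (gb (existT _ x b)) _; rewrite /T /ext /= /L E.
have bl := sz_enc_seq_mem (@eB x) l1 b l2.
case: (c) => // c'; rewrite leq_exp2r //; lia.
Qed.

End Fold.

Lemma enc_seq_map T U (e : U -> data) (h : T -> U) s :
  enc_seq e (map h s) = enc_seq (fun a => e (h a)) s.
Proof. by elim: s => //= a s ->. Qed.

Lemma tl_enc_seq T (e : T -> data) s : tl (enc_seq e s) = enc_seq e (behead s).
Proof. by case: s. Qed.

Section Terms.
Variables (X : Type) (i : X -> data).

Lemma polytime_ite (S : X -> Type) (eS : forall x, S x -> data) (b : X -> bool)
    (s1 s2 : forall x, S x) :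
  polytime i (fun x => enc_bool (b x)) ->
  polytime i (fun x => eS x (s1 x)) -> polytime i (fun x => eS x (s2 x)) ->
  polytime i (fun x => eS x (if b x then s1 x else s2 x)).
Proof.
move=> pb p1 p2; apply: polytime_eq (polytime_if pb p1 p2) => x.
by case: (b x).
Qed.

Lemma polytime_bool (b : bool) : polytime i (fun=> enc_bool b).
Proof. exact: polytime_const. Qed.

Lemma polytime_andb (b c : X -> bool) : polytime i (fun x => enc_bool (b x)) ->
  polytime i (fun x => enc_bool (c x)) -> polytime i (fun x => enc_bool (b x && c x)).
Proof.
move=> pb pc.
exact: (@polytime_ite _ (fun=> enc_bool) b c (fun=> false) pb pc (polytime_bool false)).
Qed.

Lemma polytime_orb (b c : X -> bool) : polytime i (fun x => enc_bool (b x)) ->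
  polytime i (fun x => enc_bool (c x)) -> polytime i (fun x => enc_bool (b x || c x)).
Proof.
move=> pb pc.
exact: (@polytime_ite _ (fun=> enc_bool) b (fun=> true) c pb (polytime_bool true)).
Qed.

Lemma polytime_implb (b c : X -> bool) : polytime i (fun x => enc_bool (b x)) ->
  polytime i (fun x => enc_bool (c x)) -> polytime i (fun x => enc_bool (b x ==> c x)).
Proof.
move=> pb pc.
exact: (@polytime_ite _ (fun=> enc_bool) b c (fun=> true) pb pc (polytime_bool true)).
Qed.

Lemma polytime_negb (b : X -> bool) : polytime i (fun x => enc_bool (b x)) ->
  polytime i (fun x => enc_bool (~~ b x)).
Proof.
move=> pb; exact: (@polytime_ite _ (fun=> enc_bool) b (fun=> false) (fun=> true) pb
  (polytime_bool _) (polytime_bool _)).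
Qed.

Lemma polytime_addb (b c : X -> bool) : polytime i (fun x => enc_bool (b x)) ->
  polytime i (fun x => enc_bool (c x)) -> polytime i (fun x => enc_bool (b x (+) c x)).
Proof.
move=> pb pc; have := @polytime_ite _ (fun=> enc_bool) b (fun x => ~~ c x) c pb
  (polytime_negb pc) pc.
by apply: polytime_eq => x; case: (b x).
Qed.

End Terms.

(** * Operations on lists *)

Section Lists.
Variables (X : Type) (i : X -> data).
Variables (B : X -> Type) (eB : forall x, B x -> data) (l : forall x, seq (B x)).
Hypothesis pl : polytime i (fun x => enc_seq (@eB x) (l x)).

Lemma polytime_behead : polytime i (fun x => enc_seq (@eB x) (behead (l x))).
Proof. by apply: polytime_eq (polytime_tl pl) => x; rewrite tl_enc_seq. Qed.

Lemma polytime_nilp : polytime i (fun x => enc_bool (nilp (l x))).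
Proof.
apply: polytime_eq (polytime_if pl (polytime_bool _ false) (polytime_bool _ true)) => x.
by case: (l x).
Qed.

Lemma polytime_head (d : forall x, B x) : polytime i (fun x => eB (d x)) ->
  polytime i (fun x => eB (head (d x) (l x))).
Proof.
move=> pd; apply: polytime_eq (polytime_if pl (polytime_hd pl) pd) => x.
by case: (l x).
Qed.

Lemma polytime_has (p : forall x, pred (B x)) :
  polytime (ext i eB) (fun y => enc_bool (p (projT1 y) (projT2 y))) ->
  polytime i (fun x => enc_bool (has (p x) (l x))).
Proof.
move=> pp.
have := @polytime_foldr_additive _ i B (fun=> bool) eB (fun=> enc_bool) l (fun=> false)
  (fun x b s => p x b || s) (fun=> fun=> 3) (fun=> fun=> 0) pl (polytime_bool _ _).
apply=> //=; first by apply: polytime_orb; [apply: (polytime_weak _ pp)|apply: polytime_var].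
- by move=> x [].
- exact: pb_const.
- exact: pb_const.
Qed.

Lemma polytime_all (p : forall x, pred (B x)) :
  polytime (ext i eB) (fun y => enc_bool (p (projT1 y) (projT2 y))) ->
  polytime i (fun x => enc_bool (all (p x) (l x))).
Proof.
move=> pp.
have := polytime_negb (polytime_has (p := fun x b => ~~ p x b) (polytime_negb pp)).
apply: polytime_eq => x.
by rewrite (has_predC (p x)) negbK.
Qed.

Lemma polytime_map (C : X -> Type) (eC : forall x, C x -> data) (h : forall x, B x -> C x) :
  polytime (ext i eB) (fun y => eC _ (h (projT1 y) (projT2 y))) ->
  polytime i (fun x => enc_seq (eC x) (map (h x) (l x))).
Proof.
move=> ph.
have := @polytime_foldr_additive _ i B (fun x => seq (C x)) eB (fun x => enc_seq (eC x)) l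
  (fun=> [::]) (fun x b s => h x b :: s) (fun x s => sz (enc_seq (eC x) s))
  (fun x b => sz (eC x (h x b)) + 1) pl (polytime_nil _).
apply=> //=.
- by apply: polytime_cons; [apply: (polytime_weak _ ph)|apply: polytime_var].
- by move=> x b s /=; lia.
- exact: pb_const.
- by apply: pb_add; [apply: polytime_bounded ph|apply: pb_const].
Qed.

Lemma polytime_filter (p : forall x, pred (B x)) :
  polytime (ext i eB) (fun y => enc_bool (p (projT1 y) (projT2 y))) ->
  polytime i (fun x => enc_seq (@eB x) (filter (p x) (l x))).
Proof.
move=> pp.
have := @polytime_foldr_additive _ i B (fun x => seq (B x)) eB (fun x => enc_seq (@eB x)) l
  (fun=> [::]) (fun x b s => if p x b then b :: s else s) (fun x s => sz (enc_seq (@eB x) s))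
  (fun x b => sz (eB b) + 1) pl (polytime_nil _).
apply=> //=.
- apply: (@polytime_ite _ _ (fun y => seq (B (projT1 (projT1 y)))) (fun y => enc_seq (@eB _))
    (fun y => p _ (projT2 (projT1 y)))).
  + exact: (polytime_weak _ pp).
  + by apply: polytime_cons; [apply: (polytime_weak _ (polytime_var _ _))|apply: polytime_var].
  + exact: polytime_var.
- by move=> x b s /=; case: ifP => _ /=; lia.
- exact: pb_const.
- by apply: pb_add; [exact: (polytime_bounded (polytime_var _ _))|apply: pb_const].
Qed.

Lemma polytime_cat (l' : forall x, seq (B x)) :
  polytime i (fun x => enc_seq (@eB x) (l' x)) ->
  polytime i (fun x => enc_seq (@eB x) (l x ++ l' x)).
Proof.
move=> pl'.
have := @polytime_foldr_additive _ i B (fun x => seq (B x)) eB (fun x => enc_seq (@eB x)) l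
  l' (fun x b s => b :: s) (fun x s => sz (enc_seq (@eB x) s))
  (fun x b => sz (eB b) + 1) pl pl'.
move=> H; apply: polytime_eq (H _ _ _ _ _) => //=.
- by move=> x; congr enc_seq; elim: (l x) => //= b s ->.
- by apply: polytime_cons; [apply: (polytime_weak _ (polytime_var _ _))|apply: polytime_var].
- by move=> x b s /=; lia.
- exact: polytime_bounded pl'.
- by apply: pb_add; [exact: (polytime_bounded (polytime_var _ _))|apply: pb_const].
Qed.

(** The number of entries to drop is the length of another list, so this is recursion over that list
    with [behead] as the step. Indexing and comparison of unary numbers reduce to it. *)
Lemma polytime_drop (C : X -> Type) (eC : forall x, C x -> data) (k : forall x, seq (C x)) :
  polytime i (fun x => enc_seq (eC x) (k x)) ->
  polytime i (fun x => enc_seq (@eB x) (drop (size (k x)) (l x))).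
Proof.
move=> pk.
have := @polytime_foldr_additive _ i C (fun x => seq (B x)) eC (fun x => enc_seq (@eB x)) k
  l (fun x _ s => behead s) (fun x s => sz (enc_seq (@eB x) s)) (fun=> fun=> 0) pk pl.
move=> H; apply: polytime_eq (H _ _ _ _ _) => //.
- move=> x; congr enc_seq; elim: (k x) => [|c s IH] /=; first by rewrite drop0.
  by rewrite IH -drop1 drop_drop add1n.
- apply: polytime_eq (polytime_tl (polytime_var _ _)) => y; exact: tl_enc_seq.
- by move=> x _ [|b s] /=; lia.
- exact: polytime_bounded.
- exact: pb_const.
Qed.

End Lists.

Lemma polytime_rcons X (i : X -> data) (B : X -> Type)
    (eB : forall x, B x -> data) (l : forall x, seq (B x)) (b : forall x, B x) :
  polytime i (fun x => enc_seq (@eB x) (l x)) -> polytime i (fun x => eB x (b x)) ->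
  polytime i (fun x => enc_seq (@eB x) (rcons (l x) (b x))).
Proof.
move=> pl pb; have := polytime_cat (l' := fun x => [:: b x]) pl (polytime_cons pb (polytime_nil _)).
by apply: polytime_eq => x; rewrite cats1.
Qed.

Lemma polytime_rev X (i : X -> data) (B : X -> Type) (eB : forall x, B x -> data)
    (l : forall x, seq (B x)) :
  polytime i (fun x => enc_seq (@eB x) (l x)) ->
  polytime i (fun x => enc_seq (@eB x) (rev (l x))).
Proof.
move=> pl.
have := @polytime_foldr_additive _ i B (fun x => seq (B x)) eB (fun x => enc_seq (@eB x)) l
  (fun=> [::]) (fun x b s => rcons s b) (fun x s => sz (enc_seq (@eB x) s))
  (fun x b => sz (eB _ b) + 1) pl (polytime_nil _).
move=> H; apply: polytime_eq (H _ _ _ _ _) => //.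
- by move=> x; congr enc_seq; elim: (l x) => //= b s ->; rewrite rev_cons.
- apply: (@polytime_rcons _ _ (fun y => B _) (fun y => @eB _) (fun y => projT2 y)
    (fun y => projT2 (projT1 y))); first exact: polytime_var.
  exact: (polytime_weak _ (polytime_var _ _)).
- by move=> x b; elim=> [|c s IH] /=; lia.
- exact: pb_const.
- by apply: pb_add; [exact: (polytime_bounded (polytime_var _ _))|apply: pb_const].
Qed.

Lemma polytime_last X (i : X -> data) (B : X -> Type) (eB : forall x, B x -> data)
    (d : forall x, B x) (l : forall x, seq (B x)) :
  polytime i (fun x => enc_seq (@eB x) (l x)) -> polytime i (fun x => eB x (d x)) ->
  polytime i (fun x => eB x (last (d x) (l x))).
Proof.
move=> pl pd; have := polytime_head (polytime_rev pl) pd.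
by apply: polytime_eq => x; case/lastP: (l x) => // s b; rewrite rev_rcons last_rcons.
Qed.

Lemma polytime_foldl_additive X (i : X -> data) (B S : X -> Type)
    (eB : forall x, B x -> data) (eS : forall x, S x -> data)
    (l : forall x, seq (B x)) (z : forall x, S x) (f : forall x, S x -> B x -> S x)
    (mu : forall x, S x -> nat) (g : forall x, B x -> nat) :
  polytime i (fun x => enc_seq (@eB x) (l x)) ->
  polytime i (fun x => eS x (z x)) ->
  polytime (ext (ext i eB) (fun y => @eS (projT1 y)))
    (fun y => eS _ (f _ (projT2 y) (projT2 (projT1 y)))) ->
  (forall x s, sz (@eS x s) <= mu x s) ->
  (forall x b s, mu x (f x s b) <= mu x s + g x b) ->
  pbounded i (fun x => mu x (z x)) ->
  pbounded (ext i eB) (fun y => g (projT1 y) (projT2 y)) ->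
  polytime i (fun x => eS x (foldl (@f x) (z x) (l x))).
Proof.
move=> pl pz pf szmu muf zb gb.
have := @polytime_foldr_additive _ i B S eB eS (fun x => rev (l x)) z (fun x b s => f x s b)
  mu g (polytime_rev pl) pz pf szmu muf zb gb.
by apply: polytime_eq => x; rewrite -foldl_rev revK.
Qed.

(** Intermediate computations hold vertices in unary, where an index can drive a recursion. This is
    affordable because the adjacency matrix is already larger than the number of vertices; binary is
    restored only in the output. *)
Definition enc_unary (n : nat) : data := enc_seq (fun _ : unit => Nil) (nseq n tt).

Definition enc_vertex (n : nat) (v : 'I_n) : data := enc_unary v.

Lemma sz_enc_unary n : sz (enc_unary n) = n.*2.+1.
Proof. by elim: n => //= n IH; rewrite /enc_unary /= -/(enc_unary n) IH; lia. Qed.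

Section Unary.
Variables (X : Type) (i : X -> data).

Lemma polytime_leq (m n : X -> nat) :
  polytime i (fun x => enc_unary (m x)) -> polytime i (fun x => enc_unary (n x)) ->
  polytime i (fun x => enc_bool (m x <= n x)).
Proof.
move=> pm pn; have := polytime_nilp (polytime_drop pm pn).
by apply: polytime_eq => x; rewrite /nilp size_drop !size_nseq subn_eq0.
Qed.

Lemma polytime_eqn (m n : X -> nat) :
  polytime i (fun x => enc_unary (m x)) -> polytime i (fun x => enc_unary (n x)) ->
  polytime i (fun x => enc_bool (m x == n x)).
Proof.
move=> pm pn; have := polytime_andb (polytime_leq pm pn) (polytime_leq pn pm).
by apply: polytime_eq => x; rewrite eqn_leq.
Qed.

End Unary.

(** * Vertices and tables indexed by them *)

Section VertexTables.
Variables (X : Type) (i : X -> data).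

(** The list is built from its end by incrementing all entries and prepending 0. The growth in a
    step depends on the state, so the quadratic bound on intermediate results is supplied
    directly. *)
Lemma polytime_iota (B : X -> Type) (eB : forall x, B x -> data) (l : forall x, seq (B x)) :
  polytime i (fun x => enc_seq (@eB x) (l x)) ->
  polytime i (fun x => enc_seq enc_unary (iota 0 (size (l x)))).
Proof.
move=> pl; pose s x := sz (enc_seq (@eB x) (l x)).
have iotaE x l2 : foldr (fun (_ : B x) s => 0 :: map S s) [::] l2 = iota 0 (size l2).
  by elim: l2 => //= b l2 ->; rewrite (iotaDl 1 0).
have := @polytime_foldr _ i B (fun=> seq nat) eB (fun=> enc_seq enc_unary) l
  (fun=> [::]) (fun x _ s => 0 :: map S s) (fun x => (s x * (s x + s x + 2)).+1) pl
  (polytime_nil _).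
move=> H; apply: polytime_eq (H _ _ _) => [x|||x l1 l2 E]; first by rewrite iotaE.
- apply: polytime_cons; first exact: polytime_nil.
  apply: (@polytime_map _ _ (fun=> nat) (fun=> enc_unary) _ _ (fun=> nat) (fun=> enc_unary)
    (fun=> S)); first exact: polytime_var.
  by apply: (@polytime_cons _ _ (fun=> Nil)); [exact: polytime_nil|exact: polytime_var].
- have sb := polytime_bounded pl.
  apply: (@pb_le _ _ _ (fun x => s x * (s x + s x + 2) + 1)) => [x|]; first by lia.
  apply: pb_add (pb_const _ _); apply: pb_mul => //.
  by apply: pb_add (pb_const _ _); apply: pb_add.
rewrite iotaE; have le : size l2 <= s x.
  rewrite /s E; apply: ltnW; apply: leq_trans (sz_enc_seq_size _ _) _; exact: sz_enc_seq_cat.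
apply: leq_trans (sz_enc_seq_le (M := s x + s x + 1) _) _; last by rewrite size_iota; nia.
move=> n a na; have : a \in iota 0 (size l2) by apply/onthP; exists n.
by rewrite mem_iota sz_enc_unary; lia.
Qed.

Lemma polytime_enum_vertex (n : X -> nat) (B : X -> Type) (eB : forall x, B x -> data)
    (l : forall x, seq (B x)) : (forall x, size (l x) = n x) ->
  polytime i (fun x => enc_seq (@eB x) (l x)) ->
  polytime i (fun x => enc_seq (@enc_vertex (n x)) (enum 'I_(n x))).
Proof.
move=> ln /polytime_iota; apply: polytime_eq => x.
by rewrite ln -val_enum_ord enc_seq_map.
Qed.

Variable n : X -> nat.

(** A function on vertices is stored as the list of its values; dropping [v] entries brings the
    value at [v] to the front. *)
Lemma polytime_table_lookup (e : forall x, 'I_(n x) -> data) (v : forall x, 'I_(n x)) :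
  polytime i (fun x => enc_seq (e x) (enum 'I_(n x))) ->
  polytime i (fun x => enc_vertex (v x)) ->
  polytime i (fun x => e x (v x)).
Proof.
move=> pe pv; have := polytime_hd (polytime_drop pe pv).
apply: polytime_eq => x; rewrite size_nseq.
have vn : v x < size (enum 'I_(n x)) by rewrite size_enum_ord.
by rewrite (drop_nth (v x) vn) /= nth_ord_enum.
Qed.

Lemma polytime_table (e : forall x, 'I_(n x) -> data) :
  polytime i (fun x => enc_seq (@enc_vertex (n x)) (enum 'I_(n x))) ->
  polytime (ext i (fun x => @enc_vertex (n x))) (fun y => e (projT1 y) (projT2 y)) ->
  polytime i (fun x => enc_seq (e x) (enum 'I_(n x))).
Proof.
move=> pn pe.
have := @polytime_map _ _ (fun x => 'I_(n x)) _ _ pn (fun=> data) (fun=> id) e pe.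
by apply: polytime_eq => x; rewrite enc_seq_map.
Qed.

Lemma polytime_vertex_eq (u v : forall x, 'I_(n x)) :
  polytime i (fun x => enc_vertex (u x)) -> polytime i (fun x => enc_vertex (v x)) ->
  polytime i (fun x => enc_bool (u x == v x)).
Proof. exact: polytime_eqn. Qed.

Lemma polytime_vertex_mem (u : forall x, 'I_(n x)) (l : forall x, seq 'I_(n x)) :
  polytime i (fun x => enc_vertex (u x)) ->
  polytime i (fun x => enc_seq (@enc_vertex (n x)) (l x)) ->
  polytime i (fun x => enc_bool (u x \in l x)).
Proof.
move=> pu pl.
have := @polytime_has _ _ (fun x => 'I_(n x)) _ _ pl (fun x v => val v == val (u x)).
move=> H; apply: polytime_eq (H _) => [x|]; first by rewrite -has_pred1.
apply: (@polytime_eqn); [exact: polytime_var|exact: (polytime_weak _ pu)].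
Qed.

End VertexTables.

(** * Binary arithmetic *)

Definition enc_bits : seq bool -> data := enc_seq enc_bool.

Lemma sz_enc_bits s : sz (enc_bits s) <= 4 * size s + 1.
Proof. by elim: s => //= -[] s; rewrite -/(enc_bits s) /=; lia. Qed.

Definition bval (s : seq bool) : nat := foldr (fun (b : bool) m => b + m.*2) 0 s.

Arguments bval : simpl never.

Lemma bval_nil : bval [::] = 0. Proof. by []. Qed.

Lemma bval_cons b s : bval (b :: s) = b + (bval s).*2. Proof. by []. Qed.

Lemma bval_cat s1 s2 : bval (s1 ++ s2) = bval s1 + 2 ^ size s1 * bval s2.
Proof.
elim: s1 => [|b s IH] /=; first by rewrite mul1n.
by rewrite !bval_cons IH expnS -mulnA -!mul2n; lia.
Qed.

Lemma bval_rcons s b : bval (rcons s b) = bval s + 2 ^ size s * b.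
Proof. by rewrite -cats1 bval_cat /bval /= addn0. Qed.

Lemma bval_head y : bval y = head false y + (bval (behead y)).*2.
Proof. by case: y. Qed.

Lemma bval_false T (s : seq T) : bval (map (fun=> false) s) = 0.
Proof. by elim: s => //= a s IH; rewrite bval_cons IH. Qed.

(* The state is ((remaining digits of the second summand, carry), digits of the
   result with the most significant one first). *)
Definition add_step (st : (seq bool * bool) * seq bool) (a : bool) :=
  let b := head false st.1.1 in let c := st.1.2 in
  ((behead st.1.1, if a (+) b then c else a), (a (+) b) (+) c :: st.2).

(** The induction step is the full-adder identity: two digits and a carry add up to the new digit
    plus twice the new carry. The carry counts as the digit just above those already produced. *)
Lemma add_stepsP x y c o (st := foldl add_step (y, c, o) x) :
  [/\ st.1.1 = drop (size x) y, size st.2 = size x + size o &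
    bval (rev (st.1.2 :: st.2)) + 2 ^ (size st.2) * bval (drop (size x) y) =
    bval (rev o) + 2 ^ (size o) * (c + bval x + bval y)].
Proof.
rewrite {}/st; elim: x y c o => [|a x IH] y c o /=.
  by rewrite drop0; split=> //; rewrite rev_cons bval_rcons size_rev bval_nil addn0 mulnDr addnA.
have [E1 E2 E3] := IH (behead y) (if a (+) head false y then c else a)
  ((a (+) head false y) (+) c :: o).
have Ed : drop (size x).+1 y = drop (size x) (behead y) by rewrite -drop1 drop_drop addn1.
rewrite Ed E1 E3 {}E2 /=; split=> //; first by lia.
rewrite rev_cons bval_rcons size_rev (bval_head y) expnS bval_cons.
move: (2 ^ size o) (bval x) (bval (behead y)) => k m n; clear.
by case: a (head false y) c => [] [] [] /=; nia.
Qed.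

(** Zeros are appended to [x] so that a loop over its digits also consumes all of [y]. *)
Definition add_bits (x y : seq bool) : seq bool :=
  let st := foldl add_step (y, false, [::]) (x ++ map (fun=> false) (drop (size x) y)) in
  rev (st.1.2 :: st.2).

Lemma size_pad (x y : seq bool) :
  size (x ++ map (fun=> false) (drop (size x) y)) = maxn (size x) (size y).
Proof. by rewrite size_cat size_map size_drop; lia. Qed.

Lemma bval_add_bits x y : bval (add_bits x y) = bval x + bval y.
Proof.
have [_ _] := add_stepsP (x ++ map (fun=> false) (drop (size x) y)) y false [::].
rewrite -/(add_bits x y) size_pad (@drop_oversize _ (maxn _ _) y) ?leq_maxr //.
by rewrite bval_cat bval_false /= !muln0 !addn0 mul1n.
Qed.

Lemma size_add_bits x y : size (add_bits x y) = (maxn (size x) (size y)).+1.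
Proof.
have [_ sE _] := add_stepsP (x ++ map (fun=> false) (drop (size x) y)) y false [::].
by rewrite /add_bits size_rev /= sE addn0 size_pad.
Qed.

Definition mul_bits (x y : seq bool) : seq bool :=
  foldr (fun b s => if b then add_bits y (false :: s) else false :: s) [::] x.

Lemma bval_mul_bits x y : bval (mul_bits x y) = bval x * bval y.
Proof.
elim: x => //= b x IH; case: b; rewrite ?bval_add_bits !bval_cons ?add0n IH; lia.
Qed.

Lemma size_mul_bits x y : size (mul_bits x y) <= size y + 2 * size x.
Proof. by elim: x => [|[] x IH] //=; rewrite ?size_add_bits /=; lia. Qed.

(** Digits arrive least significant first, so the flag holds the comparison of the digits read so
    far and any later difference overrides it. A nonzero digit of [y] beyond the length of [x]
    decides in favour of [y]. *)
Definition le_step (st : seq bool * bool) (a : bool) :=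
  (behead st.1, if a (+) head false st.1 then head false st.1 else st.2).

Definition le_bits (x y : seq bool) : bool :=
  let st := foldl le_step (y, true) x in has id st.1 || st.2.

Lemma le_bitsP x y : le_bits x y = (bval x <= bval y).
Proof.
(* The initial flag [r] is generalized: it is the answer in case of equal values. *)
suff H r : (let st := foldl le_step (y, r) x in has id st.1 || st.2) =
    if bval x == bval y then r else bval x < bval y.
  by rewrite [le_bits x y]H [RHS]leq_eqVlt; case: (bval x == bval y).
elim: x y r => [|a x IH] y r.
  rewrite /=; have -> : has id y = (0 < bval y).
    by elim: y => // b y IH; rewrite bval_cons
      [has id _]/(b || has id y) IH; case: b => /=; lia.
  by rewrite bval_nil; case: (bval y).
rewrite [LHS](IH (behead y) (le_step (y, r) a).2) (bval_head y) bval_cons /=.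
case: (head false y) a => [] [] /=; case: r; case: eqP => ?; case: eqP => ?; lia.
Qed.

Definition trim_bits (s : seq bool) : seq bool :=
  foldr (fun b s => if nilp s && ~~ b then [::] else b :: s) [::] s.

(** The output must be the canonical encoding given by [digits], whereas the arithmetic leaves zeros
    at the most significant end. *)
Lemma trim_bitsE s : trim_bits s = digits (bval s).
Proof.
suff [N [<- Ns]] : exists N, nat_of_bin N = bval s /\
    (if N is Npos p then pos_digits p else [::]) = trim_bits s.
  by rewrite /digits nat_of_binK.
elim: s => [|b s [N [Nv Nd]]]; first by exists N0.
rewrite bval_cons /= -/(trim_bits s) -Nv -Nd.
case: N {Nv Nd} => [|p]; case: b => /=.
- by exists (Npos xH).
- by exists N0.
- exists (Npos (xI p)); split; first by rewrite /= NatTrec.doubleE.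
  by case: (p).
- exists (Npos (xO p)); split; first by rewrite /= NatTrec.doubleE.
  by case: (p).
Qed.

Lemma bval_digits n : bval (digits n) = n.
Proof.
rewrite /digits -[RHS]bin_of_natK; case: (bin_of_nat n) => //.
by elim=> //= p IH; rewrite ?bval_cons IH NatTrec.doubleE.
Qed.

(** * Sums of nonnegative fractions *)

Section Frac.
Local Open Scope ring_scope.
Implicit Types (q : rat) (s : seq rat).

Definition num_bits q := digits `|numq q|%N.
Definition den_bits q := digits `|denq q|%N.

(** The state is an unreduced numerator and denominator in binary. Reduction is avoided, and the
    lengths still grow only linearly in the total number of digits. Signs are dropped, so this is
    meant for nonnegative summands. *)
Definition frac_step q (st : seq bool * seq bool) :=
  (add_bits (mul_bits (den_bits q) st.1) (mul_bits (num_bits q) st.2),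
   mul_bits (den_bits q) st.2).

Definition frac_sum s := foldr frac_step ([::], [:: true]) s.

Definition le_sum s1 s2 :=
  le_bits (mul_bits (frac_sum s1).1 (frac_sum s2).2) (mul_bits (frac_sum s2).1 (frac_sum s1).2).

Lemma frac_sumP s : all (fun q => 0 <= q) s ->
  (0 < bval (frac_sum s).2)%N /\
  (bval (frac_sum s).1)%:R = \sum_(q <- s) q * (bval (frac_sum s).2)%:R :> rat.
Proof.
elim: s => [|q s IH] /=; first by rewrite big_nil.
case/andP=> q0 /IH[d0 E]; rewrite bval_add_bits !bval_mul_bits !bval_digits.
split; first by rewrite muln_gt0 d0 absz_gt0 denq_neq0.
rewrite big_cons natrD !natrM E.
have den : (`|denq q|%N)%:R = (denq q)%:~R :> rat.
  by rewrite natr_absz ger0_norm // ltW // denq_gt0.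
have num : (`|numq q|%N)%:R = q * (denq q)%:~R :> rat.
  rewrite natr_absz ger0_norm ?numq_ge0 //; apply/esym.
  by rewrite -{1}(divq_num_den q) mulfVK // intr_eq0 denq_neq0.
rewrite den num -!mulr_suml; ring.
Qed.

Lemma le_sumP s1 s2 : all (fun q => 0 <= q) s1 -> all (fun q => 0 <= q) s2 ->
  le_sum s1 s2 = (\sum_(q <- s1) q <= \sum_(q <- s2) q).
Proof.
move=> /frac_sumP[d1 E1] /frac_sumP[d2 E2].
rewrite /le_sum le_bitsP !bval_mul_bits -(ler_nat rat) !natrM E1 E2 -!mulr_suml.
rewrite -mulrA [X in _ <= X]mulrAC -mulrA ler_pM2r //.
by rewrite mulr_gt0 ?ltr0n.
Qed.

End Frac.

(** * Binary arithmetic in polynomial time *)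

Section PolytimeArithmetic.
Variables (X : Type) (i : X -> data).

Section AddStep.
Let eS (st : (seq bool * bool) * seq bool) :=
  Cons (Cons (enc_bits st.1.1) (enc_bool st.1.2)) (enc_bits st.2).

Lemma polytime_add_step Y (j : Y -> data) (st : Y -> (seq bool * bool) * seq bool) (a : Y -> bool) :
  polytime j (fun y => eS (st y)) -> polytime j (fun y => enc_bool (a y)) ->
  polytime j (fun y => eS (add_step (st y) (a y))).
Proof.
move=> pst pa.
have py : polytime j (fun y => enc_bits (st y).1.1) := polytime_hd (polytime_hd pst).
have pc : polytime j (fun y => enc_bool (st y).1.2) := polytime_tl (polytime_hd pst).
have po : polytime j (fun y => enc_bits (st y).2) := polytime_tl pst.
have pb : polytime j (fun y => enc_bool (head false (st y).1.1)) :=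
  polytime_head py (polytime_bool _ false).
apply: polytime_cons; first apply: polytime_cons.
- exact: polytime_behead py.
- exact: (polytime_ite (S := fun=> bool) (eS := fun=> enc_bool) (polytime_addb pa pb) pc pa).
- exact: polytime_cons (polytime_addb (polytime_addb pa pb) pc) po.
Qed.

Lemma polytime_add_bits (x y : X -> seq bool) :
  polytime i (fun t => enc_bits (x t)) -> polytime i (fun t => enc_bits (y t)) ->
  polytime i (fun t => enc_bits (add_bits (x t) (y t))).
Proof.
move=> px py.
have pl : polytime i (fun t => enc_bits (x t ++ map (fun=> false) (drop (size (x t)) (y t)))).
  apply: (polytime_cat px).
  apply: (polytime_map (C := fun=> bool) (h := fun=> fun=> false) (polytime_drop py px)).
  exact: polytime_bool.
have pz : polytime i (fun t => eS (y t, false, [::])).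
  by apply: polytime_cons (polytime_nil _); apply: polytime_cons py (polytime_bool _ _).
(* A step shortens the second summand, replaces the carry and pushes one digit, so its growth is
   constant; 20 is a generous bound. *)
have pst := polytime_foldl_additive (S := fun=> _) (eS := fun=> eS) (f := fun=> add_step)
  (mu := fun=> fun st => sz (eS st)) (g := fun=> fun=> 20) pl pz.
have {}pst : polytime i (fun t => eS (foldl add_step (y t, false, [::])
    (x t ++ map (fun=> false) (drop (size (x t)) (y t))))).
  apply: pst => //.
  - apply: polytime_add_step; first exact: polytime_var.
    exact: (polytime_weak _ (polytime_var _ _)).
  - move=> _ a [[s c] o]; rewrite /add_step /eS /=.
    have : sz (enc_bits (behead s)) <= sz (enc_bits s) by case: s => //= b s; lia.
    have szb b : 0 < sz (enc_bool b) <= 3 by case: b.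
    have := szb c; have := szb (if a (+) head false s then c else a).
    have := szb (a (+) head false s (+) c); lia.
  - exact: polytime_bounded pz.
  - exact: pb_const.
apply: polytime_rev; apply: polytime_cons (polytime_tl pst).
exact: (polytime_tl (polytime_hd pst)).
Qed.

End AddStep.
End PolytimeArithmetic.

Section PolytimeMul.
Variables (X : Type) (i : X -> data).

Lemma polytime_mul_bits (x y : X -> seq bool) :
  polytime i (fun t => enc_bits (x t)) -> polytime i (fun t => enc_bits (y t)) ->
  polytime i (fun t => enc_bits (mul_bits (x t) (y t))).
Proof.
move=> px py.
(* The measure charges each digit the maximal 4, so that it depends on the number of digits only. A
   round adds at most [size (y t) + 2] digits. *)
have pp := polytime_foldr_additive (S := fun=> seq bool) (eS := fun=> enc_bits)
  (f := fun t (b : bool) s => if b then add_bits (y t) (false :: s) else false :: s)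
  (mu := fun=> fun s => 4 * size s + 1) (g := fun t _ => 4 * (size (y t) + 2))
  (z := fun=> [::]) px (polytime_nil _).
apply: pp.
- have ps : polytime (ext (ext i (fun=> enc_bool)) (fun=> enc_bits))
      (fun t => enc_bits (false :: projT2 t)).
    exact: polytime_cons (polytime_nil _) (polytime_var _ _).
  apply: (polytime_ite (S := fun=> seq bool) (eS := fun=> enc_bits) _ _ ps).
    exact: (polytime_weak _ (polytime_var _ _)).
  exact: (polytime_add_bits (polytime_weak _ (polytime_weak _ py)) ps).
- by move=> _ s; apply: sz_enc_bits.
- by move=> t [] s /=; rewrite ?size_add_bits /=; lia.
- exact: pb_const.
- have yb := polytime_bounded (polytime_weak (fun=> enc_bool) py).
  apply: (@pb_le _ _ _ (fun t => 4 * (sz (enc_bits (y (projT1 t))) + 2))).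
    by move=> t; have := sz_enc_seq_size enc_bool (y (projT1 t)); rewrite /enc_bits; lia.
  by apply: pb_mul; [exact: pb_const|apply: pb_add => //; exact: pb_const].
Qed.

Lemma polytime_le_bits (x y : X -> seq bool) :
  polytime i (fun t => enc_bits (x t)) -> polytime i (fun t => enc_bits (y t)) ->
  polytime i (fun t => enc_bool (le_bits (x t) (y t))).
Proof.
move=> px py; pose eS (st : seq bool * bool) := Cons (enc_bits st.1) (enc_bool st.2).
have pz : polytime i (fun t => eS (y t, true)).
  by apply: polytime_cons py (polytime_bool _ _).
have pst := polytime_foldl_additive (S := fun=> _) (eS := fun=> eS) (f := fun=> le_step)
  (mu := fun=> fun st => sz (eS st)) (g := fun=> fun=> 20) px pz.
have {}pst : polytime i (fun t => eS (foldl le_step (y t, true) (x t))).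
  apply: pst => //.
  - have ps : polytime (ext (ext i (fun=> enc_bool)) (fun=> eS)) (fun t => enc_bits (projT2 t).1).
      exact: polytime_hd (polytime_var _ _).
    have pa : polytime (ext (ext i (fun=> enc_bool)) (fun=> eS))
        (fun t => enc_bool (projT2 (projT1 t))).
      exact: (polytime_weak _ (polytime_var _ _)).
    have pb := polytime_head ps (polytime_bool _ false).
    apply: polytime_cons; first exact: polytime_behead ps.
    apply: (polytime_ite (S := fun=> bool) (eS := fun=> enc_bool) (polytime_addb pa pb) pb).
    exact: (polytime_tl (polytime_var _ _)).
  - move=> _ a [s r]; rewrite /le_step /eS /=.
    have : sz (enc_bits (behead s)) <= sz (enc_bits s) by case: s => //= b s; lia.
    have szb b : 0 < sz (enc_bool b) <= 3 by case: b.
    have := szb r; have := szb (if a (+) head false s then head false s else r); lia.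
  - exact: polytime_bounded pz.
  - exact: pb_const.
apply: polytime_orb (polytime_tl pst).
have ph : polytime i (fun t => enc_bits (foldl le_step (y t, true) (x t)).1) := polytime_hd pst.
exact: (polytime_has (p := fun=> id) ph (polytime_var _ _)).
Qed.

Lemma polytime_trim_bits (x : X -> seq bool) :
  polytime i (fun t => enc_bits (x t)) -> polytime i (fun t => enc_bits (trim_bits (x t))).
Proof.
move=> px.
have pp := polytime_foldr_additive (S := fun=> seq bool) (eS := fun=> enc_bits)
  (f := fun t (b : bool) s => if nilp s && ~~ b then [::] else b :: s)
  (mu := fun=> fun s => sz (enc_bits s)) (g := fun=> fun=> 4) (z := fun=> [::]) px (polytime_nil _).
apply: pp => //.
- have ps := polytime_var (ext i (fun=> enc_bool)) (fun=> enc_bits).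
  have pb := polytime_weak (fun=> enc_bits) (polytime_var i (fun=> enc_bool)).
  apply: (polytime_ite (S := fun=> seq bool) (eS := fun=> enc_bits)).
  + exact: polytime_andb (polytime_nilp ps) (polytime_negb pb).
  + exact: polytime_nil.
  + exact: polytime_cons pb ps.
- move=> _ b s; case: ifP => _ /=; first by lia.
  by rewrite -/(enc_bits s); case: b => /=; lia.
- exact: pb_const.
- exact: pb_const.
Qed.

(** Adding one per unary mark and then trimming gives the canonical digits; each addition lengthens
    the list by at most two digits. *)
Lemma polytime_nat_of_unary (n : X -> nat) :
  polytime i (fun t => enc_unary (n t)) -> polytime i (fun t => enc_nat (n t)).
Proof.
move=> pn.
pose f (_ : unit) s := add_bits [:: true] s.
have pp := polytime_foldr_additive (S := fun=> seq bool) (eS := fun=> enc_bits)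
  (f := fun=> f) (mu := fun=> fun s => 4 * size s + 1) (g := fun=> fun=> 8)
  (z := fun=> [::]) pn (polytime_nil _).
have {}pp : polytime i (fun t => enc_bits (foldr f [::] (nseq (n t) tt))).
  apply: pp => //.
  - exact: (polytime_add_bits (polytime_const _ (enc_bits [:: true])) (polytime_var _ _)).
  - by move=> _ s; apply: sz_enc_bits.
  - by move=> _ b s; rewrite /f size_add_bits /=; lia.
  - exact: pb_const.
  - exact: pb_const.
apply: polytime_eq (polytime_trim_bits pp) => t.
rewrite trim_bitsE /enc_nat /enc_bits; congr (enc_seq _ (digits _)).
by elim: (n t) => //= m IH; rewrite /f bval_add_bits IH.
Qed.

End PolytimeMul.

Lemma polytime_le_sum X (i : X -> data) (s1 s2 : X -> seq rat) :
  polytime i (fun t => enc_seq enc_rat (s1 t)) -> polytime i (fun t => enc_seq enc_rat (s2 t)) ->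
  polytime i (fun t => enc_bool (le_sum (s1 t) (s2 t))).
Proof.
pose eS (st : seq bool * seq bool) := Cons (enc_bits st.1) (enc_bits st.2).
have psum s : polytime i (fun t => enc_seq enc_rat (s t)) ->
    polytime i (fun t => eS (frac_sum (s t))).
  move=> ps.
  (* By [size_mul_bits], adding [q] lengthens numerator and denominator to at most the old maximum
     plus [2 * k q + 1]; the factor 8 charges 4 per digit for both. *)
  pose k q := size (den_bits q) + size (num_bits q).
  have pp := polytime_foldr_additive (S := fun=> _) (eS := fun=> eS)
    (f := fun=> frac_step) (mu := fun=> fun st => 8 * maxn (size st.1) (size st.2) + 3)
    (g := fun=> fun q => 8 * (2 * k q + 1)) (z := fun=> ([::], [:: true])) ps
    (polytime_const _ (eS ([::], [:: true]))).
  apply: pp => //.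
  - pose j := ext (ext i (fun=> enc_rat)) (fun=> eS).
    have pst : polytime j (fun t => eS (projT2 t)) := polytime_var _ _.
    have pq : polytime j (fun t => enc_rat (projT2 (projT1 t))).
      exact: (polytime_weak _ (polytime_var _ _)).
    have pnum : polytime j (fun t => enc_bits (num_bits (projT2 (projT1 t)))).
      exact: polytime_tl (polytime_hd pq).
    have pden : polytime j (fun t => enc_bits (den_bits (projT2 (projT1 t)))).
      exact: polytime_tl (polytime_tl pq).
    have p1 : polytime j (fun t => enc_bits (projT2 t).1) := polytime_hd pst.
    have p2 : polytime j (fun t => enc_bits (projT2 t).2) := polytime_tl pst.
    have pm1 := polytime_mul_bits pden p1; have pm2 := polytime_mul_bits pnum p2.
    exact: polytime_cons (polytime_add_bits pm1 pm2) (polytime_mul_bits pden p2).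
  - by move=> _ st; rewrite /eS /=; have := sz_enc_bits st.1; have := sz_enc_bits st.2; lia.
  - move=> _ q [a b]; rewrite /= size_add_bits /k.
    have := size_mul_bits (den_bits q) a; have := size_mul_bits (num_bits q) b.
    have := size_mul_bits (den_bits q) b; lia.
  - exact: pb_const.
  - apply: (@pb_le _ _ _ (fun t => 8 * (2 * sz (enc_rat (projT2 t)) + 1))) => [t|].
      rewrite /k /enc_rat /enc_int /=.
      have := sz_enc_seq_size enc_bool (den_bits (projT2 t)).
      have := sz_enc_seq_size enc_bool (num_bits (projT2 t)).
      by rewrite /enc_nat /num_bits /den_bits; lia.
    apply: pb_mul; first exact: pb_const.
    apply: pb_add; last exact: pb_const.
    apply: pb_mul; first exact: pb_const.
    exact: (polytime_bounded (polytime_var _ _)).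
move=> /psum p1 /psum p2; apply: polytime_le_bits; apply: polytime_mul_bits.
- exact: (polytime_hd p1).
- exact: (polytime_tl p2).
- exact: (polytime_hd p2).
- exact: (polytime_tl p1).
Qed.

(** * Paths and distances in trees *)

Local Open Scope ring_scope.

Section TreePaths.
Variables (R : realFieldType) (V : finType) (G : wgraph R V).
Implicit Types (u v x y z : V) (s p : seq V) (A : {set V}).

Lemma path_length_nil u : path_length G u [::] = 0.
Proof. by rewrite /path_length big_nil. Qed.

Lemma path_length_cons u x s :
  path_length G u (x :: s) = weight G u x + path_length G x s.
Proof. by rewrite /path_length /= big_cons. Qed.

Lemma path_length_cat u s1 s2 :
  path_length G u (s1 ++ s2) = path_length G u s1 + path_length G (last u s1) s2.
Proof.
elim: s1 u => [|x s1 IH] u /=; first by rewrite path_length_nil add0r.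
by rewrite !path_length_cons IH addrA.
Qed.

Lemma path_length_ge0 u s : path (edge G) u s -> 0 <= path_length G u s.
Proof.
elim: s u => [|x s IH] u /=; first by rewrite path_length_nil.
by case/andP=> ux /IH; rewrite path_length_cons => ?; rewrite addr_ge0 ?weight_ge0.
Qed.

Lemma path_length_rev u s :
  path (edge G) u s ->
  path_length G (last u s) (rev (belast u s)) = path_length G u s.
Proof.
elim: s u => [|x s IH] u /=; first by [].
case/andP=> ux xs; rewrite rev_cons -cats1 path_length_cat IH //.
have -> : last (last x s) (rev (belast x s)) = x by case: (s) => //= *; rewrite rev_cons last_rcons.
by rewrite path_length_cons path_length_nil path_length_cons addr0 addrC (weight_sym ux).
Qed.

Lemma rev_path_sym u s :
  path (edge G) (last u s) (rev (belast u s)) = path (edge G) u s.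
Proof. by rewrite rev_path; apply: eq_path => x y; rewrite edge_sym. Qed.

Lemma last_rev_belast u s : last (last u s) (rev (belast u s)) = u.
Proof. by case: s => //= x s; rewrite rev_cons last_rcons. Qed.

Lemma cons_rev_belast u s : last u s :: rev (belast u s) = rev (u :: s).
Proof. by rewrite -rev_rcons -lastI. Qed.

(** As for [path], the starting vertex is left out. In a tree the simple path is unique, so the
    choice made by [pick] does not matter. *)
Definition tree_path u v : seq V :=
  if [pick s : #|V|.-bseq V | simple_path G setT u v s] is Some s then s else [::].

Definition tree_path_from u v : seq V := u :: tree_path u v.

Definition tree_dist u v : R := path_length G u (tree_path u v).

Local Notation tp := tree_path.
Local Notation pth := tree_path_from.
Local Notation d := tree_dist.
Local Notation simple := (simple_path G setT).

Lemma simpleP u v s :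
  reflect [/\ path (edge G) u s, last u s = v & uniq (u :: s)] (simple u v s).
Proof.
apply: (iffP and4P) => [[-> /eqP -> -> _] //|[-> -> us]]; split=> //.
by apply/allP => x _; rewrite /= inE.
Qed.

Hypothesis tG : is_tree G.

(* If u :: x :: s and u :: y :: s' were simple paths to the same vertex with
   x != y, a path from x to y avoiding u would close into a cycle. *)
Lemma simple_path_uniq u v s s' : simple u v s -> simple u v s' -> s = s'.
Proof.
case: tG => _ acyc.
elim: s u s' => [|x s IH] u [|y s'] // /simpleP[] /=.
- move=> _ <- _ /simpleP[] /= _ us /andP[]; move: (mem_last y s').
  by rewrite us => ->.
- move=> _ <- /andP[uxs _] /simpleP[] /= _ E.
  by move: (mem_last x s); rewrite -E (negPf uxs).
case/andP=> ux xs xv /andP[uxs us] /simpleP[] /= /andP[uy ys] yv /andP[uys us'].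
have [E|nxy] := eqVneq x y.
  subst y; congr cons; apply: (IH x).
  - by apply/simpleP.
  - by apply/simpleP.
pose q := s ++ rev (belast y s').
have pq : path (edge G) x q.
  by rewrite cat_path xs /= xv -yv rev_path_sym.
have lq : last x q = y by rewrite last_cat xv -yv last_rev_belast.
have uq : u \notin x :: q.
  rewrite -cat_cons mem_cat (negPf uxs) /= mem_rev.
  by apply: contra uys => /mem_belast.
case: (shortenP pq) lq => q' pq' uq' sub lq'.
(* If [q'] were empty, [x] would equal [y]; so the closed walk through [u] has at least three
   vertices. *)
have nq : (2 < size [:: u, x & q'])%N.
  by case: (q') lq' => //= lq'; rewrite lq' eqxx in nxy.
case/negP: (acyc _ nq); rewrite /ucycleb /=.
rewrite ux rcons_path pq' lq' edge_sym uy /= -/(uniq (x :: q')) uq' andbT.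
by apply: contra uq; rewrite !inE => /orP[->//|/sub ->]; rewrite orbT.
Qed.

Lemma tree_pathP u v : simple u v (tp u v).
Proof.
case: tG => con _; rewrite /tp; case: pickP => [s //|no].
have /connectP[s us] := con u v.
case: (shortenP us) => s' us' uniq' _ vE.
have sz : (size s' <= #|V|)%N.
  apply: leq_trans (leqnSn _) _.
  by rewrite -[(size s').+1]/(size (u :: s')) -(card_uniqP uniq') max_card.
by have /simpleP[] := no (Bseq sz).
Qed.

Lemma tree_path_unique u v s : simple u v s -> tp u v = s.
Proof. exact: simple_path_uniq (tree_pathP u v). Qed.

Lemma path_tree_path u v : path (edge G) u (tp u v).
Proof. by have /simpleP[] := tree_pathP u v. Qed.

Lemma last_tree_path u v : last u (tp u v) = v.
Proof. by have /simpleP[] := tree_pathP u v. Qed.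

Lemma uniq_tree_path u v : uniq (pth u v).
Proof. by have /simpleP[] := tree_pathP u v. Qed.

Lemma tree_path_start u v : u \in pth u v.
Proof. exact: mem_head. Qed.

Lemma tree_path_end u v : v \in pth u v.
Proof. by rewrite -{1}(last_tree_path u v) mem_last. Qed.

Lemma tree_path_refl u : tp u u = [::].
Proof. by apply: tree_path_unique; apply/simpleP. Qed.

(** Any walk can be shortened to a simple path on some of its vertices, and that is the tree path by
    uniqueness. *)
Lemma tree_path_sub u v s :
  path (edge G) u s -> last u s = v -> {subset pth u v <= u :: s}.
Proof.
move=> us uv; case: (shortenP us) uv => s' us' uniq' sub uv x.
rewrite /pth (tree_path_unique (s := s')); last by apply/simpleP.
by rewrite !inE => /orP[->//|/sub ->]; rewrite orbT.
Qed.

Lemma tree_path_split_at u v s1 x s2 : pth u v = s1 ++ x :: s2 ->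
  pth u x = rcons s1 x /\ tp x v = s2.
Proof.
have /simpleP[] := tree_pathP u v; rewrite -/(pth u v) => up uv uniq_uv E.
move: E up uv uniq_uv; rewrite /pth; case: s1 => [|y s1] /=.
  by case=> -> -> xs xv xU; rewrite tree_path_refl; split=> //;
    apply: tree_path_unique; apply/simpleP.
case=> <- -> {y}; rewrite cat_path last_cat /= => /and3P[p1 p2 p3] xv.
rewrite cat_uniq mem_cat negb_or => /andP[/andP[u1 u2] /and3P[s1U dis xU]].
split; last by apply: tree_path_unique; apply/simpleP.
congr cons; apply: tree_path_unique; apply/simpleP.
rewrite rcons_path p1 p2 last_rcons /= mem_rcons rcons_uniq s1U !inE negb_or.
move: u2 dis; rewrite /= !inE !negb_or => /andP[-> _] /andP[-> _].
by rewrite u1.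
Qed.

Lemma tree_path_split u v x :
  x \in pth u v -> tp u v = tp u x ++ tp x v.
Proof.
case/splitPr E: {-}(pth u v) / => [s1 s2].
have [Eu ->] := tree_path_split_at E.
have : pth u v = pth u x ++ s2 by rewrite E Eu cat_rcons.
by case.
Qed.

Lemma tree_path_join u v x :
  (forall y, y \in pth u x -> y \notin tp x v) -> tp u v = tp u x ++ tp x v.
Proof.
move=> dis; apply: tree_path_unique; apply/simpleP.
rewrite cat_path last_cat !last_tree_path !path_tree_path; split=> //.
have U' : uniq (tp x v) by have /andP[] := uniq_tree_path x v.
rewrite -cat_cons cat_uniq uniq_tree_path U' andbT /=.
by apply/hasPn => y yx; apply: contraL yx => /dis.
Qed.

Lemma tree_path_rev u v : pth v u = rev (pth u v).
Proof.
have E := cons_rev_belast u (tp u v); rewrite last_tree_path in E.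
rewrite -E; congr cons; apply: tree_path_unique; apply/simpleP.
rewrite E rev_uniq uniq_tree_path -{1 3}(last_tree_path u v) rev_path_sym.
by rewrite path_tree_path last_rev_belast.
Qed.

Lemma mem_tree_path_sym u v x : (x \in pth u v) = (x \in pth v u).
Proof. by rewrite (tree_path_rev u v) mem_rev. Qed.

Lemma mem_tree_path_tri v u w x :
  x \in pth u w -> (x \in pth u v) || (x \in pth v w).
Proof.
have W : path (edge G) u (tp u v ++ tp v w).
  by rewrite cat_path last_tree_path !path_tree_path.
have L : last u (tp u v ++ tp v w) = w by rewrite last_cat !last_tree_path.
move/(tree_path_sub W L); rewrite -cat_cons mem_cat => /orP[->//|xvw].
by rewrite [in X in _ || X]inE xvw !orbT.
Qed.

Lemma tree_dist_refl u : d u u = 0.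
Proof. by rewrite /d tree_path_refl path_length_nil. Qed.

Lemma tree_dist_ge0 u v : 0 <= d u v.
Proof. exact: path_length_ge0 (path_tree_path u v). Qed.

Lemma tree_dist_sym u v : d u v = d v u.
Proof.
rewrite /d -(path_length_rev (path_tree_path v u)) last_tree_path.
have E := cons_rev_belast v (tp v u); rewrite last_tree_path -/(pth v u) in E.
by have := tree_path_rev v u; rewrite -E => -[->].
Qed.

Lemma tree_dist_split u v x : x \in pth u v -> d u v = d u x + d x v.
Proof. by move=> /tree_path_split E; rewrite /d E path_length_cat last_tree_path. Qed.

(** Induction on the walk: if [u] lies on the tree path from the next vertex [x], then [u] is no
    farther from the end than [x] is; otherwise prepending the first edge to that path gives the
    tree path from [u]. *)
Lemma tree_dist_le_walk u s : path (edge G) u s -> d u (last u s) <= path_length G u s.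
Proof.
elim: s u => [|x s IH] u /=; first by rewrite tree_dist_refl path_length_nil.
case/andP=> ux /IH; rewrite path_length_cons; set v := last x s => le_xv.
apply: le_trans (lerD (lexx _) le_xv).
have [uxv|uxv] := boolP (u \in pth x v).
  rewrite (tree_dist_split uxv); have := weight_ge0 ux; have := tree_dist_ge0 x u; lra.
rewrite {1}/d (tree_path_unique (s := x :: tp x v)) ?path_length_cons //.
apply/simpleP; rewrite /= last_tree_path ux path_tree_path; split=> //.
by rewrite uxv; apply: uniq_tree_path.
Qed.

Lemma tree_dist_tri u v w : d u w <= d u v + d v w.
Proof.
have W : path (edge G) u (tp u v ++ tp v w).
  by rewrite cat_path last_tree_path !path_tree_path.
have := tree_dist_le_walk W.
by rewrite path_length_cat last_cat !last_tree_path.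
Qed.

End TreePaths.

(** * Distances in induced subgraphs of a tree *)

Section TreeDist.
Variables (R : realFieldType) (V : finType) (G : wgraph R V).
Hypothesis tG : is_tree G.
Local Notation pth := (tree_path_from G).
Local Notation d := (tree_dist G).

Lemma dist_le_tree_dist (A : {set V}) u v :
  {subset pth u v <= A} -> (dist G A u v <= (d u v)%:E)%E.
Proof.
move=> sub; have [up uv U] := simpleP _ _ _ _ (tree_pathP tG u v).
have sz : (size (tree_path G u v) <= #|V|)%N.
  apply: leq_trans (leqnSn _) _.
  by rewrite -[_.+1]/(size (pth u v)) -(card_uniqP U) max_card.
apply: (@bigmin_le_cond _ _ _ _ (Bseq sz)).
by apply/and4P; split=> //; [apply/eqP|apply/allP => x /sub].
Qed.

Lemma tree_dist_le_dist (A : {set V}) u v : ((d u v)%:E <= dist G A u v)%E.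
Proof.
apply/bigmin_geP; split=> [|s]; first exact: leey.
case/and4P=> us /eqP uv U _.
by rewrite /d (tree_path_unique tG (s := s)) //; apply/simpleP.
Qed.

(** A finite distance is witnessed by a simple path inside [A], and the tree has only one such path
    between the two vertices. *)
Lemma dist_lty_tree_path (A : {set V}) u v :
  (dist G A u v < +oo)%E -> {subset pth u v <= A}.
Proof.
move=> lty.
have [/existsP[s]|no] := boolP [exists s : #|V|.-bseq V, simple_path G A u v s].
  case/and4P=> us /eqP uv U /allP sA x.
  by rewrite /tree_path_from (tree_path_unique tG (s := s)); [exact: sA|apply/simpleP].
have E : dist G A u v = +oo%E.
  rewrite /dist big_pred0 // => s; apply/negbTE.
  by apply: contra no => us; apply/existsP; exists s.
by rewrite E ltxx in lty.
Qed.

End TreeDist.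

(** * The solution on a tree rooted at [r] *)

Section ClusterAggregation.
Variables (R : realFieldType) (V : finType) (I : instance R V) (r : V).
Implicit Types (u v x y z p q : V).
Local Notation G := (graph I).
Local Notation D := (Delta I).
Local Notation pth := (tree_path_from G).
Local Notation tp := (tree_path G).
Local Notation d := (tree_dist G).

(** This and the following definitions are written as scans of explicit lists, so that they
    translate directly into polynomial-time terms. *)
Definition same_cluster u v := has (fun C : {set V} => (u \in C) && (v \in C)) (enum (clusters I)).

Definition is_top x := ~~ has (fun y => same_cluster y x && (y != x)) (pth r x).

Definition portal_list := [seq p <- enum V | p \in portals I].

Definition below x p := x \in pth r p.

Definition good_top x :=
  is_top x &&
  has (fun p => below x p && all (fun q => d x p <= d x q + (D + D)) portal_list)
    portal_list.

Definition home_top v := last r [seq x <- pth r v | good_top x].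

Definition nearest_below x :=
  [seq p <- portal_list | below x p &&
     all (fun q => below x q ==> (d x p <= d x q)) portal_list].

(** Taking the first element breaks ties by the fixed order of [enum V], hence consistently at all
    vertices; [head_nearest_below_between] depends on this. *)
Definition vertex_portal v := head r (nearest_below (home_top v)).

Definition tree_solution (C : {set V}) := vertex_portal (head r [seq v <- enum V | v \in C]).

Hypothesis tG : is_tree G.
Hypothesis P0 : portals I != set0.

Lemma mem_portal_list p : (p \in portal_list) = (p \in portals I).
Proof. by rewrite mem_filter mem_enum andbT. Qed.

Lemma same_clusterP u v :
  reflect (pblock (clusters I) u = pblock (clusters I) v) (same_cluster u v).
Proof.
have /and3P[/eqP cov tI _] := clusters_partition I.
have inC w : w \in cover (clusters I) by rewrite cov inE.
apply: (iffP hasP) => [[C]|E].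
  rewrite mem_enum => CI /andP[uC vC].
  by rewrite (def_pblock tI CI uC) (def_pblock tI CI vC).
exists (pblock (clusters I) u); first by rewrite mem_enum pblock_mem.
by rewrite mem_pblock inC E mem_pblock inC.
Qed.

Lemma same_cluster_sym u v : same_cluster u v -> same_cluster v u.
Proof. by move=> /same_clusterP E; apply/same_clusterP. Qed.

Lemma same_cluster_trans v u w : same_cluster u v -> same_cluster v w -> same_cluster u w.
Proof. by move=> /same_clusterP E /same_clusterP E'; apply/same_clusterP; rewrite E. Qed.

Lemma same_cluster_refl u : same_cluster u u.
Proof. exact/same_clusterP. Qed.

(** The distance inside the cluster is at most [D], hence finite. Finiteness keeps the tree path
    inside the cluster, and the tree distance is at most the distance in the induced subgraph. *)
Lemma same_cluster_dist u v : same_cluster u v ->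
  (forall x, x \in pth u v -> same_cluster u x) /\ d u v <= D.
Proof.
case/hasP=> C; rewrite mem_enum => CI /andP[uC vC].
have le : (dist G C u v <= D%:E)%E.
  apply: le_trans (clusters_diam CI); apply: le_trans (le_bigmax_cond _ _ uC).
  exact: (le_bigmax_cond _ (fun v => dist G C u v) vC).
split; last by rewrite -lee_fin; apply: le_trans le; apply: tree_dist_le_dist.
move=> x ux; apply/hasP; exists C; rewrite ?mem_enum // uC.
by apply: (dist_lty_tree_path tG _ ux); apply: le_lt_trans le _; apply: ltry.
Qed.

Lemma Delta_ge0 : 0 <= D.
Proof.
have [_] := same_cluster_dist (same_cluster_refl r).
by rewrite tree_dist_refl.
Qed.

Lemma nearest_portal v : exists2 q, q \in portals I &
  forall p, p \in portals I -> d v q <= d v p.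
Proof.
case/set0Pn: P0 => p0 p0P.
by case: (arg_minP (d v) p0P) => q qP qmin; exists q.
Qed.

Lemma below_refl x : below x x. Proof. exact: tree_path_end. Qed.

Lemma below_root x : below r x. Proof. exact: tree_path_start. Qed.

Lemma below_split x p : below x p -> pth r p = pth r x ++ tp x p.
Proof. by move=> /(tree_path_split tG) E; rewrite /tree_path_from E. Qed.

Lemma below_trans y x z : below x y -> below y z -> below x z.
Proof. by move=> xy /below_split E; rewrite /below E mem_cat -/(below x y) xy. Qed.

Lemma below_between x p y : below x p -> y \in pth x p -> below x y /\ below y p.
Proof.
move=> xp yxp; have E := below_split xp.
have yp : below y p.
  rewrite /below E mem_cat; move: yxp; rewrite inE => /orP[/eqP->|->]; last by rewrite orbT.
  by rewrite tree_path_end.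
split=> //; move: (xp); rewrite /below (below_split yp) mem_cat => /orP[//|xyp].
(* Were [x] also on the path from [y] to [p], splitting both paths would give [tp x y] and [tp y x]
   total length 0, so [x] and [y] coincide. *)
have xyp' : x \in pth y p by rewrite inE xyp orbT.
have := congr1 size (tree_path_split tG yxp).
rewrite (tree_path_split tG xyp') !size_cat => szE.
have /size0nil xy0 : size (tp x y) = 0%N by lia.
by rewrite -(last_tree_path tG x y) xy0 /= tree_path_end.
Qed.

Lemma below_anti x y : below x y -> below y x -> x = y.
Proof.
move=> /[dup] xy /below_split E /below_split E'.
have /size0nil tp0 : size (tp x y) = 0%N.
  by move: (congr1 size E) (congr1 size E'); rewrite !size_cat; lia.
by rewrite -(last_tree_path tG x y) tp0.
Qed.

Lemma between_below x y p : below x y -> below y p -> y \in pth x p.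
Proof.
move=> xy /[dup] yp; rewrite /below (below_split (below_trans xy yp)) mem_cat.
case/orP=> [yx|]; last by rewrite inE => ->; rewrite orbT.
by rewrite (below_anti yx xy) tree_path_start.
Qed.

(** If a vertex after [w] satisfied [a], the last such vertex, which is [w], would occur strictly
    after [w] on a simple path. *)
Lemma last_filterP (a : pred V) u (w := last r [seq x <- pth r u | a x]) : a r ->
  [/\ below w u, a w & {in tp w u, forall x, ~~ a x}].
Proof.
move=> ar.
have : w \in r :: [seq x <- pth r u | a x] by exact: mem_last.
rewrite inE mem_filter => wE.
have wu : below w u by case/orP: wE => [/eqP->|/andP[]//]; apply: below_root.
split=> //; first by case/orP: wE => [/eqP->|/andP[]].
move=> x xwu; apply/negP => ax.
have E := below_split wu.
have: w \in [seq x <- tp w u | a x].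
  have lastin (z : V) s : x \in s -> last z s \in s by case: s => // y s _; exact: (mem_last y s).
  have Ew : w = last (last r [seq x <- pth r w | a x]) [seq x <- tp w u | a x].
    by rewrite {1}/w E filter_cat last_cat.
  by rewrite {1}Ew; apply: lastin; rewrite mem_filter ax.
rewrite mem_filter => /andP[_ wwu].
by have := uniq_tree_path tG w u; rewrite /= wwu.
Qed.

(** The witness is the lowest common ancestor: the last vertex on the root path of [u] that is also
    above [v]. Past it the paths to [u] and [v] are disjoint, so together they form the path between
    [u] and [v]. *)
Lemma branch_vertex u v : exists w, [/\ below w u, below w v, w \in pth u v &
  forall x, below x u -> below x v -> below x w].
Proof.
have [] := @last_filterP (below^~ v) u (below_root v).
set w := last _ _ => wu wv no; exists w; split=> // [|x xu xv]; last first.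
  move: xu; rewrite {1}/below (below_split wu) mem_cat.
  by case/orP=> // /no; rewrite xv.
suff E : tp u v = tp u w ++ tp w v.
  by rewrite /tree_path_from E -cat_cons mem_cat tree_path_end.
apply: (tree_path_join tG) => y; rewrite (mem_tree_path_sym tG) => ywu.
apply/negP => ywv.
have [_ yv] := below_between wv (mem_behead (s := pth w v) ywv).
move: ywu; rewrite inE => /orP[/eqP yw|/no]; last by rewrite yv.
by have := uniq_tree_path tG w v; rewrite /= -{1}yw ywv.
Qed.

Lemma good_root : good_top r.
Proof.
apply/andP; split.
  by rewrite /is_top /tree_path_from (tree_path_refl tG) /= eqxx andbF.
have [q qP qmin] := nearest_portal r.
apply/hasP; exists q; rewrite ?mem_portal_list // below_root.
apply/allP => p; rewrite mem_portal_list => /qmin.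
have := Delta_ge0; lra.
Qed.

Lemma home_topP v :
  [/\ below (home_top v) v, good_top (home_top v) &
      {in tp (home_top v) v, forall x, ~~ good_top x}].
Proof. exact: last_filterP good_root. Qed.

Lemma below_home x v : below x v -> good_top x -> below x (home_top v).
Proof.
have [av _ no] := home_topP v; rewrite {1}/below (below_split av) mem_cat.
by case/orP=> // /no /negPf->.
Qed.

Lemma home_top_unique x v : below x v -> good_top x ->
  {in tp x v, forall y, ~~ good_top y} -> home_top v = x.
Proof.
move=> xv gx no; apply: below_anti; last exact: below_home.
have [] := home_topP v; rewrite {1}/below (below_split xv) mem_cat.
by case/orP=> // /no /negPf->.
Qed.

Lemma home_top_between v y : below (home_top v) y -> below y v ->
  home_top y = home_top v.
Proof.
have [av ga no] := home_topP v => ay yv.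
apply: home_top_unique => // x xay; apply: no.
by rewrite (tree_path_split tG (between_below ay yv)) mem_cat xay.
Qed.

(** The path from [w] down to [v] stays in their cluster, and no vertex on it after [w] is a top,
    since [w] lies above it in the same cluster. So no good top comes between. *)
Lemma home_top_down w v : below w v -> same_cluster w v -> home_top v = home_top w.
Proof.
move=> wv swv; have [aw ga no] := home_topP w.
apply: home_top_unique => //; first exact: below_trans aw wv.
rewrite (tree_path_split tG (between_below aw wv)) => y.
rewrite mem_cat => /orP[/no//|ywv]; rewrite negb_and; apply/orP; left.
have ywv' : y \in pth w v by rewrite inE ywv orbT.
have [wy _] := below_between wv ywv'.
rewrite negbK; apply/hasP; exists w => //.
have [/(_ _ ywv') -> _] := same_cluster_dist swv.
by apply/eqP => wy'; have := uniq_tree_path tG w v; rewrite /= {1}wy' ywv.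
Qed.

(** The lowest common ancestor of [u] and [v] lies on the path between them, hence in their cluster,
    and both compare with it by [home_top_down]. *)
Lemma home_top_cluster u v : same_cluster u v -> home_top u = home_top v.
Proof.
move=> suv; have [w [wu wv wuv _]] := branch_vertex u v.
have [/(_ _ wuv) suw _] := same_cluster_dist suv.
rewrite (@home_top_down w u) ?(@home_top_down w v) //.
  by apply: same_cluster_trans suv; apply: same_cluster_sym.
exact: same_cluster_sym.
Qed.

Lemma nearest_belowP x p :
  reflect [/\ p \in portals I, below x p &
    forall q, q \in portals I -> below x q -> d x p <= d x q] (p \in nearest_below x).
Proof.
rewrite mem_filter mem_portal_list.
apply: (iffP andP) => [[/andP[-> /allP H] ->]|[-> -> H]]; split=> //.
  by move=> q qP xq; have := H q; rewrite mem_portal_list qP xq => /(_ isT).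
apply/andP; split=> //; apply/allP=> q; rewrite mem_portal_list => /H.
by case: below => // ->.
Qed.

Lemma head_nearest_below x p : p \in portals I -> below x p ->
  head r (nearest_below x) \in nearest_below x.
Proof.
move=> pP xp; have c0 : (p \in portals I) && below x p by rewrite pP.
case: (arg_minP (P := fun p => (p \in portals I) && below x p) (d x) c0) => q /andP[qP xq] qmin.
have : q \in nearest_below x.
  by apply/nearest_belowP; split=> // p' p'P xp'; apply: qmin; rewrite p'P.
by case: (nearest_below x) => //= y s _; apply: mem_head.
Qed.

(** For portals below [y], the distances from [x] and from [y] differ by the constant [d x y]. Hence
    the nearest portals below [y] are those nearest below [x] that lie below [y], in the same order,
    and the first one survives the filter. *)
Lemma head_nearest_below_between x y (p := head r (nearest_below x)) :
  p \in nearest_below x -> below x y -> below y p ->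
  head r (nearest_below y) = p.
Proof.
move=> /[dup] pn /nearest_belowP[pP xp pmin] xy yp.
suff -> : nearest_below y = [seq q <- nearest_below x | below y q].
  move: pn yp; rewrite /p; case: (nearest_below x) => //= q s _ ->.
  by [].
rewrite /nearest_below -filter_predI; apply: eq_in_filter => q.
rewrite mem_portal_list => qP /=.
have dsplit q' : below y q' -> d x q' = d x y + d y q'.
  by move=> yq'; apply: (tree_dist_split tG); apply: between_below.
case yq: (below y q) => //=; rewrite (below_trans xy yq) /=.
apply/allP/allP => qmin q'; rewrite mem_portal_list => q'P; apply/implyP => bq'.
  have := qmin p; rewrite mem_portal_list pP yp => /(_ isT) /=.
  have := pmin q' q'P bq'; rewrite (dsplit q) // (dsplit p) //; lra.
have := qmin q'; rewrite mem_portal_list q'P (below_trans xy bq') => /(_ isT) /=.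
by rewrite (dsplit q) // (dsplit q') // lerD2l.
Qed.

Lemma vertex_portalP v : vertex_portal v \in nearest_below (home_top v).
Proof.
have [_ /andP[_ /hasP[p pP /andP[ap _]]] _] := home_topP v.
by rewrite mem_portal_list in pP; apply: head_nearest_below ap.
Qed.

(** This makes the served sets closed under paths to the portal. Such a path runs inside the walk
    from [v] up to [a], its home top, and down to the portal. On the first leg the home top stays
    [a]; on the second the home top of [y] lies between [a] and the portal, which therefore remains
    the first nearest one. *)
Lemma vertex_portal_between v y :
  y \in pth v (vertex_portal v) -> vertex_portal y = vertex_portal v.
Proof.
have pn := vertex_portalP v; have /nearest_belowP[_ ap _] := pn.
have [av ga _] := home_topP v; set a := home_top v in pn ap av ga *.
case/(mem_tree_path_tri tG a)/orP.
  rewrite (mem_tree_path_sym tG) => yav; have [ay yv] := below_between av yav.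
  by rewrite /vertex_portal (@home_top_between v y).
move=> yap; have [ay yp] := below_between ap yap.
rewrite {1}/vertex_portal (@head_nearest_below_between a) //.
  exact: below_home.
by apply: below_trans yp; have [] := home_topP y.
Qed.

(** The witness is the first vertex on the root path of [v] that shares its cluster. *)
Lemma cluster_top v : exists t, [/\ below t v, same_cluster t v & is_top t].
Proof.
have hv : has (same_cluster^~ v) (pth r v).
  by apply/hasP; exists v; [exact: below_refl|exact: same_cluster_refl].
have [s1 [t [s2 [E tv no]]]] : exists s1 t s2, [/\ pth r v = rcons s1 t ++ s2,
    same_cluster t v & ~~ has (same_cluster^~ v) s1].
  by case: (split_find hv) => t s1 s2; exists s1, t, s2.
rewrite cat_rcons in E; have [Et _] := tree_path_split_at tG E.
exists t; split=> //; first by rewrite /below E mem_cat mem_head orbT.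
apply/hasPn => y; rewrite Et mem_rcons inE => /orP[/eqP->|ys].
  by rewrite eqxx andbF.
rewrite negb_and; apply/orP; left; apply: contra no => yt.
by apply/hasP; exists y => //; apply: same_cluster_trans tv.
Qed.

Lemma vertex_portal_top_dist t q : is_top t -> q \in portals I ->
  d t (vertex_portal t) <= d t q + (D + D).
Proof.
move=> tt qP; have [q0 q0P q0min] := nearest_portal t.
(* It suffices to compare with a portal nearest to [t], which is called [q] from here on. *)
apply: le_trans (lerD (q0min _ qP) (lexx _)).
move: q0 q0P q0min {q qP} => q qP qmin.
have [at_ ga no] := home_topP t; have /andP[ta /hasP[p' p'P /andP[ap' /allP p'min]]] := ga.
have /nearest_belowP[pP ap pmin] := vertex_portalP t.
set p := vertex_portal t in pP ap pmin *.
set a := home_top t in at_ ga ta no ap ap' p'min pmin *.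
rewrite mem_portal_list in p'P.
have dtp := tree_dist_tri tG t a p.
(* If [q] is not below [a], the path from [t] to [q] passes through [a], and the goodness of [a]
   costs at most [D + D]. *)
have [aq|naq] := boolP (below a q); last first.
  have atq : a \in pth t q.
    have /orP[/(negP naq)//|] := mem_tree_path_tri tG q at_.
    by rewrite (mem_tree_path_sym tG).
  have := p'min q; rewrite mem_portal_list qP (tree_dist_split tG atq) => /(_ isT).
  have := pmin p' p'P ap'; lra.
have [u [ut uq utq umax]] := branch_vertex t q.
have [t1 [t1u st1u tt1]] := cluster_top u.
have [_ dt1u] := same_cluster_dist st1u.
(* If the top [t1] of the cluster of [u] is good, then [a] lies between [t1] and [u], so
   [d a u <= D], and the detour from [u] through [a] costs twice that distance. *)
have [gt1|] := boolP (good_top t1).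
  have t1a : below t1 a := below_home (below_trans t1u ut) gt1.
  have atu : a \in pth t1 u := between_below t1a (umax _ at_ aq).
  have := pmin q qP aq; rewrite (tree_dist_split tG utq).
  have := tree_dist_tri tG a u q; have := tree_dist_tri tG t u a.
  rewrite (tree_dist_sym tG u a); move: dt1u; rewrite (tree_dist_split tG atu).
  have := tree_dist_ge0 tG t1 a; lra.
(* Otherwise, since [q] is below [t1], some portal [q'] is closer to [t1] than [q] by more than
   [D + D]. As [d u t1 <= D], it is also closer to [u], and then to [t], contradicting the choice of
   [q]. *)
rewrite /good_top tt1 /= => /hasPn /(_ q); rewrite mem_portal_list qP.
rewrite (below_trans t1u uq) => /(_ isT) /allPn[q']; rewrite mem_portal_list => q'P.
rewrite -ltNge; have := tree_dist_tri tG t1 u q; have := qmin q' q'P.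
have := tree_dist_tri tG t u q'; have := tree_dist_tri tG u t1 q'.
rewrite (tree_dist_split tG utq) (tree_dist_sym tG u t1); lra.
Qed.

Lemma vertex_portal_cluster u v : same_cluster u v -> vertex_portal u = vertex_portal v.
Proof. by rewrite /vertex_portal => /home_top_cluster ->. Qed.

Lemma vertex_portal_dist v q : q \in portals I ->
  d v (vertex_portal v) <= d v q + 4%:R * D.
Proof.
move=> qP; have [t [_ tv tt]] := cluster_top v.
have := vertex_portal_top_dist tt qP; rewrite (vertex_portal_cluster tv).
have [_ dtv] := same_cluster_dist tv.
have := tree_dist_tri tG v t (vertex_portal v); have := tree_dist_tri tG t v q.
rewrite (tree_dist_sym tG v t); lra.
Qed.

Lemma tree_solutionE C v : C \in clusters I -> v \in C -> tree_solution C = vertex_portal v.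
Proof.
move=> CI vC; rewrite /tree_solution; apply: vertex_portal_cluster.
apply/hasP; exists C; rewrite ?mem_enum // vC andbT.
have : v \in [seq v <- enum V | v \in C] by rewrite mem_filter vC mem_enum.
case E: [seq _ <- _ | _] => [//|x s] _ /=.
by have : x \in x :: s := mem_head x s; rewrite -E mem_filter => /andP[].
Qed.

Lemma portal_of_tree_solution v : portal_of I tree_solution v = vertex_portal v.
Proof.
have /and3P[/eqP cov tI _] := clusters_partition I.
have vC : v \in cover (clusters I) by rewrite cov inE.
by rewrite /portal_of (@tree_solutionE _ v (pblock_mem vC)) // mem_pblock.
Qed.

Lemma tree_solution_correct : is_solution I 4%:R tree_solution.
Proof.
split=> [C CI|v].
  have /and3P[_ _ n0] := clusters_partition I.
  have [C0|[v vC]] := set_0Vmem C; first by rewrite C0 (negPf n0) in CI.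
  by rewrite (tree_solutionE CI vC); have /nearest_belowP[] := vertex_portalP v.
rewrite portal_of_tree_solution.
have [q qP qmin] := nearest_portal v.
(* The tree path to the portal stays in the served set, so the induced distance is at most the tree
   distance. *)
apply: (@le_trans _ _ (d v (vertex_portal v))%:E).
  apply: (dist_le_tree_dist tG) => y /vertex_portal_between E.
  by rewrite inE portal_of_tree_solution E.
apply: (@le_trans _ _ ((d v q)%:E + (4%:R * D)%:E)%E).
  by rewrite -EFinD lee_fin vertex_portal_dist.
apply: leeD => //; apply/bigmin_geP; split=> [|p pP]; first exact: leey.
by apply: le_trans (tree_dist_le_dist tG _ _ _); rewrite lee_fin qmin.
Qed.

End ClusterAggregation.

(** * Computing the solution *)

Section WalkTable.
Variables (R : realFieldType) (V : finType) (G : wgraph R V).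
Implicit Types (u v x y : V) (s : seq V) (T : V -> seq (V * R)).

(** Off the edges [weight] is arbitrary and absent from the encoding, hence the value 0. *)
Definition edge_weight x y : R := if edge G x y then weight G x y else 0.

(* T x lists the vertices of a path from x to the target, each with the weight
   of the edge leaving it; it is empty as long as no path from x is known. *)
Definition walk_step T x : seq (V * R) :=
  if nilp (T x) then
    if has (fun y => edge G x y && ~~ nilp (T y)) (enum V) then
      (x, edge_weight x (head x [seq y <- enum V | edge G x y && ~~ nilp (T y)])) ::
        T (head x [seq y <- enum V | edge G x y && ~~ nilp (T y)])
    else [::]
  else T x.

Definition walk_start v x : seq (V * R) := if x == v then [:: (v, 0)] else [::].

(** The list [enum V] only counts rounds; a simple path has fewer edges than the graph has vertices,
    so these suffice. *)
Definition walk_table v : V -> seq (V * R) :=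
  foldr (fun _ => walk_step) (walk_start v) (enum V).

Hypothesis tG : is_tree G.
Local Notation tp := (tree_path G).

Definition weighted_path v x : seq (V * R) :=
  zip (tree_path_from G x v) (rcons (pairmap (weight G) x (tp x v)) 0).

(** If [x] were on the path from [y], its own path would be no longer than that of [y]; so the edge
    can be prepended. *)
Lemma tree_path_edge v x y : edge G x y -> (size (tp y v) < size (tp x v))%N ->
  tp x v = y :: tp y v.
Proof.
move=> xy lt; apply: (tree_path_unique tG); apply/simpleP.
rewrite /= xy path_tree_path // last_tree_path //; split=> //.
have := uniq_tree_path tG y v; rewrite /= => ->; rewrite andbT.
by apply: contraL lt => /(tree_path_split tG) ->; rewrite size_cat -leqNgt leq_addl.
Qed.

Lemma weighted_path_cons v x y : tp x v = y :: tp y v ->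
  weighted_path v x = (x, weight G x y) :: weighted_path v y.
Proof. by rewrite /weighted_path /tree_path_from => -> /=. Qed.

Lemma weighted_path_nnil v x : ~~ nilp (weighted_path v x).
Proof.
by rewrite /nilp /weighted_path size_zip size_rcons size_pairmap minnn.
Qed.

(** After [size s] rounds the known vertices are exactly those at most that many edges from [v]. A
    known neighbour of an unknown vertex is strictly closer to [v], hence the next vertex on its
    tree path, whichever one [head] picks. *)
Lemma foldr_walk_step v s x :
  foldr (fun _ => walk_step) (walk_start v) s x =
  if (size (tp x v) <= size s)%N then weighted_path v x else [::].
Proof.
elim: s x => [|z s IH] x /=.
  rewrite leqn0 /walk_start; have [->|xv] := eqVneq x v.
    by rewrite /weighted_path /tree_path_from tree_path_refl.
  by have := last_tree_path tG x v; case: (tp x v) => //= xE; rewrite xE eqxx in xv.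
rewrite /walk_step IH; set T := foldr _ _ s.
have nT y : ~~ nilp (T y) = (size (tp y v) <= size s)%N.
  by rewrite /T IH; case: ifP => _; rewrite ?weighted_path_nnil.
case: leqP => [le|lt] /=; first by rewrite (negPf (weighted_path_nnil _ _)) leqW.
have step y : edge G x y && ~~ nilp (T y) -> tp x v = y :: tp y v.
  by rewrite nT => /andP[xy le]; apply: tree_path_edge => //; apply: leq_ltn_trans lt.
case: ifP => [hy|no]; last first.
  case: leqP => // le; case E: (tp x v) lt le => [|y q] // _ le.
  have [xy qE] : edge G x y /\ q = tp y v.
    have /simpleP[] := tree_pathP tG x v; rewrite E /= => /andP[xy yq] qv /andP[_ U].
    by split=> //; apply/esym/(tree_path_unique tG)/simpleP.
  by have /hasPn/(_ y) := negbT no; rewrite mem_enum xy nT -qE => /(_ isT) /negP[].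
have : head x [seq y <- enum V | edge G x y && ~~ nilp (T y)] \in
    [seq y <- enum V | edge G x y && ~~ nilp (T y)].
  by move: hy; rewrite has_filter; case: [seq _ <- _ | _] => //= a q _; apply: mem_head.
move: (head _ _) => y; rewrite mem_filter => /andP[/[dup] /andP[xy Ty] /step E _].
rewrite nT in Ty; rewrite E /= ltnS Ty (weighted_path_cons E) /edge_weight xy.
by rewrite /T IH Ty.
Qed.

Lemma walk_tableE v x : walk_table v x = weighted_path v x.
Proof.
rewrite /walk_table foldr_walk_step -cardE ifT //; apply: leq_trans (leqnSn _) _.
by rewrite -[_.+1]/(size (tree_path_from G x v)) -(card_uniqP (uniq_tree_path tG x v)) max_card.
Qed.

Lemma size_weighted_path v x :
  size (tree_path_from G x v) = size (rcons (pairmap (weight G) x (tp x v)) 0).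
Proof. by rewrite size_rcons size_pairmap. Qed.

Lemma walk_table_path v x : [seq p.1 | p <- walk_table v x] = tree_path_from G x v.
Proof.
rewrite walk_tableE; apply: (@unzip1_zip _ _ (tree_path_from G x v)).
by rewrite size_weighted_path.
Qed.

Lemma walk_table_weights v x :
  [seq p.2 | p <- walk_table v x] = rcons (pairmap (weight G) x (tp x v)) 0.
Proof.
rewrite walk_tableE; apply: (@unzip2_zip _ _ (tree_path_from G x v)).
by rewrite size_weighted_path.
Qed.

Lemma walk_table_dist v x :
  \sum_(w <- [seq p.2 | p <- walk_table v x]) w = tree_dist G x v.
Proof. by rewrite walk_table_weights big_rcons /= addr0. Qed.

Lemma walk_table_ge0 v x : all (fun w => 0 <= w) [seq p.2 | p <- walk_table v x].
Proof.
rewrite walk_table_weights all_rcons lexx /=.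
have := path_tree_path tG x v; move: (tp x v) => s.
elim: s x => //= y s IH x /andP[xy /IH ->].
by rewrite weight_ge0.
Qed.

End WalkTable.

(** Bundling the instance with its hypotheses provides the index type for [polytime]. The root is
    vertex 0, whose unary code is the constant [Nil]. *)
Record tree_input := TreeInput {
  input_order : nat;
  input_instance : instance rat 'I_input_order;
  input_root : 'I_input_order;
  input_root_eq0 : input_root = 0%N :> nat;
  input_tree : is_tree (graph input_instance);
  input_portals : portals input_instance != set0
}.

Definition enc_input (t : tree_input) : data := enc_instance (input_instance t).

Definition enc_walk n (p : 'I_n * rat) : data := Cons (enc_vertex p.1) (enc_rat p.2).

Definition enc_walk_table m (T : 'I_m -> seq ('I_m * rat)) : data :=
  enc_seq (fun u => enc_seq (@enc_walk m) (T u)) (enum 'I_m).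

(** * Reading the encoded instance *)

Section Inputs.
Variables (X : Type) (i : X -> data) (h : X -> tree_input).
Hypothesis pin : polytime i (fun x => enc_input (h x)).

Local Notation n x := (input_order (h x)).
Local Notation V x := 'I_(input_order (h x)).
Local Notation I x := (input_instance (h x)).
Local Notation G x := (graph (I x)).

Lemma polytime_vertices : polytime i (fun x => enc_seq (@enc_vertex (n x)) (enum (V x))).
Proof.
have pG : polytime i (fun x => enc_graph (G x)) := polytime_hd pin.
by apply: polytime_enum_vertex pG => x; rewrite size_enum_ord.
Qed.

Lemma polytime_root : polytime i (fun x => enc_vertex (input_root (h x))).
Proof.
by apply: polytime_eq (polytime_nil i) => x; rewrite /enc_vertex input_root_eq0.
Qed.

Lemma polytime_clusters :
  polytime i (fun x => enc_seq (@enc_set (n x)) (enum (clusters (I x)))).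
Proof. exact: polytime_hd (polytime_tl pin). Qed.

Lemma polytime_Delta : polytime i (fun x => enc_rat (Delta (I x))).
Proof. exact: polytime_hd (polytime_tl (polytime_tl pin)). Qed.

Lemma polytime_mem_set (A : forall x, {set V x}) (v : forall x, V x) :
  polytime i (fun x => enc_set (A x)) -> polytime i (fun x => enc_vertex (v x)) ->
  polytime i (fun x => enc_bool (v x \in A x)).
Proof. exact: (polytime_table_lookup (e := fun x u => enc_bool (u \in A x))). Qed.

Section Edges.
Variables u v : forall x, V x.
Hypothesis pu : polytime i (fun x => enc_vertex (u x)).
Hypothesis pv : polytime i (fun x => enc_vertex (v x)).

Lemma polytime_adjacency : polytime i (fun x => enc_option enc_rat
  (if edge (G x) (u x) (v x) then Some (weight (G x) (u x) (v x)) else None)).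
Proof.
have pG : polytime i (fun x => enc_graph (G x)) := polytime_hd pin.
pose e x (a b : V x) :=
  enc_option enc_rat (if edge (G x) a b then Some (weight (G x) a b) else None).
have prow := polytime_table_lookup (e := fun x a => enc_seq (e x a) (enum (V x))) pG pu.
exact: (polytime_table_lookup (e := fun x => e x (u x)) prow pv).
Qed.

Lemma polytime_edge : polytime i (fun x => enc_bool (edge (G x) (u x) (v x))).
Proof.
have := polytime_if polytime_adjacency (polytime_bool i true) (polytime_bool i false).
by apply: polytime_eq => x; case: edge.
Qed.

Lemma polytime_edge_weight : polytime i (fun x => enc_rat (edge_weight (G x) (u x) (v x))).
Proof.
have := polytime_if polytime_adjacency (polytime_hd polytime_adjacency)
  (polytime_const i (enc_rat 0)).
by apply: polytime_eq => x; rewrite /edge_weight; case: edge.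
Qed.

End Edges.
End Inputs.

Section WalkStep.
Variables (X : Type) (i : X -> data) (h : X -> tree_input).
Hypothesis pin : polytime i (fun x => enc_input (h x)).

Local Notation n x := (input_order (h x)).
Local Notation V x := 'I_(input_order (h x)).
Local Notation I x := (input_instance (h x)).
Local Notation G x := (graph (I x)).

Lemma polytime_walk_step (T : forall x, V x -> seq (V x * rat)) :
  polytime i (fun x => enc_walk_table (T x)) ->
  polytime i (fun x => enc_walk_table (walk_step (G x) (T x))).
Proof.
move=> pT; have pV := polytime_vertices pin.
pose j := ext i (fun x => @enc_vertex (n x)).
have pu : polytime j (fun y => enc_vertex (projT2 y)) := polytime_var _ _.
have pinj : polytime j (fun y => enc_input (h (projT1 y))) := polytime_weak _ pin.
have lookup Y (k : Y -> data) (g : Y -> X) (a : forall y, V (g y)) :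
    polytime k (fun y => enc_walk_table (T (g y))) ->
    polytime k (fun y => enc_vertex (a y)) ->
    polytime k (fun y => enc_seq (@enc_walk _) (T (g y) (a y))).
  exact: (polytime_table_lookup (e := fun y b => enc_seq (@enc_walk _) (T (g y) b))).
have pTj : polytime j (fun y => enc_walk_table (T (projT1 y))) := polytime_weak _ pT.
have pVj : polytime j (fun y => enc_seq (@enc_vertex _) (enum (V (projT1 y)))).
  exact: polytime_weak _ pV.
have pTu := lookup _ _ (fun y => projT1 y) _ pTj pu.
pose q (y : {x : X & V x}) (b : V (projT1 y)) :=
  edge (G (projT1 y)) (projT2 y) b && ~~ nilp (T (projT1 y) b).
have pcond : polytime (ext j (fun y => @enc_vertex (n (projT1 y))))
    (fun y => enc_bool (q (projT1 y) (projT2 y))).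
  apply: polytime_andb.
    apply: polytime_edge (polytime_var _ _); first exact: (polytime_weak _ pinj).
    exact: (polytime_weak _ pu).
  apply/polytime_negb/polytime_nilp.
  exact: (lookup _ _ (fun y => projT1 (projT1 y)) _ (polytime_weak _ pTj) (polytime_var _ _)).
have pnext := polytime_head (polytime_filter (p := q) pVj pcond) pu.
apply: (polytime_table pV); rewrite /walk_step.
apply: (polytime_ite (eS := fun y => enc_seq (@enc_walk (n (projT1 y)))) (polytime_nilp pTu) _ pTu).
apply: (polytime_ite (eS := fun y => enc_seq (@enc_walk (n (projT1 y))))
  (polytime_has (p := q) pVj pcond)); last exact: polytime_nil.
apply: polytime_cons; last exact: (lookup _ _ (fun y => projT1 y) _ pTj pnext).
exact: (polytime_cons pu (polytime_edge_weight pinj pu pnext)).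
Qed.

End WalkStep.

(** A new list extends one from the previous round by a single entry, so the length of each list is
    at most one more than the number of rounds. Many vertices may copy the same list, so the lists
    are bounded one by one instead of bounding the growth of the table. *)
Lemma sz_walk m (K : wgraph rat 'I_m) (v : 'I_m) M T (s : seq T) u :
  (forall a b, (sz (enc_walk (a, edge_weight K a b)) <= M)%N) ->
  (sz (enc_walk (v, 0%R)) <= M)%N ->
  (sz (enc_seq (@enc_walk m) (foldr (fun _ => walk_step K) (walk_start rat v) s u)) <=
    (size s).+1 * M.+1 + 1)%N.
Proof.
move=> wM vM; elim: s u => [|z s IH] u /=.
  by rewrite /walk_start; case: eqP => _; rewrite /enc_walk /= in vM *; lia.
rewrite mulSn -addnA; set N := (_ * _ + 1)%N in IH *.
move: (foldr _ _ s) IH => T' IH; rewrite /walk_step.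
case: ifP => _; last exact: leq_trans (IH u) (leq_addl _ _).
case: ifP => _ //=; move: (head _ _) => w.
have := IH w; have := wM u w; rewrite /enc_walk /=; lia.
Qed.

(** * Paths and distance comparisons in polynomial time *)

Section Walks.
Variables (X : Type) (i : X -> data) (h : X -> tree_input).
Hypothesis pin : polytime i (fun x => enc_input (h x)).

Local Notation n x := (input_order (h x)).
Local Notation V x := 'I_(input_order (h x)).
Local Notation I x := (input_instance (h x)).
Local Notation G x := (graph (I x)).

Lemma polytime_walk_table (u v : forall x, V x) :
  polytime i (fun x => enc_vertex (u x)) -> polytime i (fun x => enc_vertex (v x)) ->
  polytime i (fun x => enc_seq (@enc_walk (n x)) (walk_table (G x) (v x) (u x))).
Proof.
move=> pu pv; have pV := polytime_vertices pin; have bV := polytime_bounded pV.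
pose L x := sz (enc_seq (@enc_vertex (n x)) (enum (V x))).
have nL x : (n x < L x)%N.
  by have := sz_enc_seq_size (@enc_vertex (n x)) (enum (V x)); rewrite size_enum_ord.
have pstart : polytime i (fun x => enc_walk (v x, 0)).
  exact: (polytime_cons pv (polytime_const _ (enc_rat 0))).
have bstart := polytime_bounded pstart.
pose j := ext (ext i (fun x => @enc_vertex (n x))) (fun y => @enc_vertex (n (projT1 y))).
(* One table entry is bounded uniformly in its pair of vertices, since it is itself the value of a
   polynomial-time term in the context extended by both. In [M] below, [4 * L x + 5] bounds the
   added size of that context, with the successor from [pbounded]. *)
have [c bw] : pbounded j (fun y => sz (enc_walk (projT2 (projT1 y),
    edge_weight (G (projT1 (projT1 y))) (projT2 (projT1 y)) (projT2 y)))).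
  have pa : polytime j (fun y => enc_vertex (projT2 (projT1 y))).
    exact: (polytime_weak _ (polytime_var _ _)).
  have pb : polytime j (fun y => enc_vertex (projT2 y)) := polytime_var _ _.
  have pj := polytime_weak (fun y => @enc_vertex (n (projT1 y)))
    (polytime_weak (fun x => @enc_vertex (n x)) pin).
  exact: (polytime_bounded (polytime_cons pa (polytime_edge_weight pj pa pb))).
pose M x := ((sz (i x) + (4 * L x + 5)) ^ c + sz (enc_walk (v x, 0%R)))%N.
have bM : pbounded i M.
  apply: pb_add => //; apply: pb_exp; apply: pb_add; first exact: pb_size.
  by apply: pb_add; [apply: pb_mul => //|]; apply: pb_const.
pose S x := V x -> seq (V x * rat).
have pz : polytime i (fun x => enc_walk_table (walk_start rat (v x))).
  apply: (polytime_table pV).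
  apply: (polytime_ite (S := fun y => seq (V (projT1 y) * rat))
    (eS := fun y => enc_seq (@enc_walk _))).
  - exact: (polytime_vertex_eq (n := fun y => n (projT1 y)) (u := fun y => projT2 y)
      (v := fun y => v (projT1 y)) (polytime_var _ _) (polytime_weak _ pv)).
  - exact: polytime_cons (polytime_weak _ pstart) (polytime_nil _).
  - exact: polytime_nil.
have ptable : polytime i (fun x => enc_walk_table (walk_table (G x) (v x))).
  apply: (polytime_foldr (S := S) (eS := fun x => @enc_walk_table (n x))
    (f := fun x _ => walk_step (G x))
    (bnd := fun x => ((L x * ((L x).+1 * (M x).+1 + 2)) + 1)%N) pV pz).
  - exact: (polytime_walk_step (h := fun y => h (projT1 (projT1 y))) (T := fun y => projT2 y)
      (polytime_weak _ (polytime_weak _ pin)) (polytime_var _ _)).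
  - apply: pb_add; last exact: pb_const.
    apply: pb_mul => //; apply: pb_add; last exact: pb_const.
    have bS g : pbounded i g -> pbounded i (fun x => (g x).+1).
      by move=> bg; apply: pb_le (pb_add (pb_const i 1) bg).
    by apply: pb_mul; apply: bS.
  move=> x l1 l2 E; have lL : (size l2 < L x)%N.
    have := nL x; have := congr1 size E; rewrite size_enum_ord size_cat; lia.
  rewrite /enc_walk_table; apply: leq_trans (sz_enc_seq_le _) _.
    move=> _ a _; apply: (@sz_walk _ _ _ (M x)) => [a' b|]; last exact: leq_addl.
    apply: leq_trans (leq_addr _ _); apply: leq_trans (bw (existT _ (existT _ x a') b)) _.
    rewrite /j /ext /= /enc_vertex !sz_enc_unary.
    have := ltn_ord a'; have := ltn_ord b; have := nL x.
    by case: (c) => // c' *; rewrite leq_exp2r //; lia.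
  rewrite size_enum_ord [X in (_ <= X)%N]addn1 ltnS; apply: leq_mul; first exact: ltnW (nL x).
  rewrite addn1 addn2 2!ltnS; apply: leq_mul => //; lia.
exact: (polytime_table_lookup
  (e := fun x a => enc_seq (@enc_walk _) (walk_table (G x) (v x) a)) ptable pu).
Qed.

Lemma polytime_tree_path_from (u v : forall x, V x) :
  polytime i (fun x => enc_vertex (u x)) -> polytime i (fun x => enc_vertex (v x)) ->
  polytime i (fun x => enc_seq (@enc_vertex (n x)) (tree_path_from (G x) (u x) (v x))).
Proof.
move=> pu pv; have pw := polytime_walk_table pu pv.
have := polytime_map (C := fun x => V x) (eC := fun x => @enc_vertex (n x))
  (h := fun x p => p.1) pw (polytime_hd (polytime_var _ _)).
by apply: polytime_eq => x; rewrite walk_table_path //; apply: input_tree.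
Qed.

Lemma polytime_path_weights (u v : forall x, V x) :
  polytime i (fun x => enc_vertex (u x)) -> polytime i (fun x => enc_vertex (v x)) ->
  polytime i (fun x => enc_seq enc_rat [seq p.2 | p <- walk_table (G x) (v x) (u x)]).
Proof.
move=> pu pv; have pw := polytime_walk_table pu pv.
exact: (polytime_map (C := fun=> rat) (eC := fun=> enc_rat)
  (h := fun x p => p.2) pw (polytime_tl (polytime_var _ _))).
Qed.

Lemma polytime_le_dist (u v w : forall x, V x) :
  polytime i (fun x => enc_vertex (u x)) -> polytime i (fun x => enc_vertex (v x)) ->
  polytime i (fun x => enc_vertex (w x)) ->
  polytime i (fun x => enc_bool
    (tree_dist (G x) (u x) (v x) <= tree_dist (G x) (u x) (w x))).
Proof.
move=> pu pv pw.
have := polytime_le_sum (polytime_path_weights pu pv) (polytime_path_weights pu pw).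
apply: polytime_eq => x; have tG := input_tree (h x).
by rewrite le_sumP ?walk_table_ge0 // !walk_table_dist.
Qed.

(** The slack enters as two further summands, which [Delta_ge0] shows to be nonnegative, as
    [le_sumP] requires. *)
Lemma polytime_le_dist_slack (u v w : forall x, V x) :
  polytime i (fun x => enc_vertex (u x)) -> polytime i (fun x => enc_vertex (v x)) ->
  polytime i (fun x => enc_vertex (w x)) ->
  polytime i (fun x => enc_bool (tree_dist (G x) (u x) (v x) <=
    tree_dist (G x) (u x) (w x) + (Delta (I x) + Delta (I x)))).
Proof.
move=> pu pv pw; have pD := polytime_Delta pin.
have := polytime_le_sum (polytime_path_weights pu pv)
  (s2 := fun x => [:: Delta (I x), Delta (I x) & _])
  (polytime_cons pD (polytime_cons pD (polytime_path_weights pu pw))).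
apply: polytime_eq => x; have tG := input_tree (h x).
have D0 := Delta_ge0 (input_root (h x)) tG.
rewrite le_sumP ?walk_table_ge0 //=; last by rewrite D0 walk_table_ge0.
by rewrite !big_cons !walk_table_dist // addrA [in RHS]addrC.
Qed.

End Walks.

Local Notation vertex h x := 'I_(input_order (h x)).
Local Notation enc_v h := (fun x => @enc_vertex (input_order (h x))).
Local Notation inst h x := (input_instance (h x)).

Lemma polytime_same_cluster X (i : X -> data) (h : X -> tree_input) (u v : forall x, vertex h x) :
  polytime i (fun x => enc_input (h x)) ->
  polytime i (fun x => enc_vertex (u x)) -> polytime i (fun x => enc_vertex (v x)) ->
  polytime i (fun x => enc_bool (same_cluster (inst h x) (u x) (v x))).
Proof.
move=> pin pu pv.
have pC := polytime_var i (fun x => @enc_set (input_order (h x))).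
apply: (polytime_has (p := fun x C => (u x \in C) && (v x \in C)) (polytime_clusters pin)).
apply: polytime_andb.
  exact: (polytime_mem_set (h := fun y => h (projT1 y)) (A := fun y => projT2 y)
    (v := fun y => u (projT1 y)) pC (polytime_weak _ pu)).
exact: (polytime_mem_set (h := fun y => h (projT1 y)) (A := fun y => projT2 y)
  (v := fun y => v (projT1 y)) pC (polytime_weak _ pv)).
Qed.

Lemma polytime_below X (i : X -> data) (h : X -> tree_input) (u v : forall x, vertex h x) :
  polytime i (fun x => enc_input (h x)) ->
  polytime i (fun x => enc_vertex (u x)) -> polytime i (fun x => enc_vertex (v x)) ->
  polytime i (fun x => enc_bool (below (inst h x) (input_root (h x)) (u x) (v x))).
Proof.
move=> pin pu pv; apply: (polytime_vertex_mem pu).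
exact: (polytime_tree_path_from pin (polytime_root _ _) pv).
Qed.

Lemma polytime_is_top X (i : X -> data) (h : X -> tree_input) (u : forall x, vertex h x) :
  polytime i (fun x => enc_input (h x)) ->
  polytime i (fun x => enc_vertex (u x)) ->
  polytime i (fun x => enc_bool (is_top (inst h x) (input_root (h x)) (u x))).
Proof.
move=> pin pu; apply: polytime_negb.
apply: (polytime_has (p := fun x y => same_cluster (inst h x) y (u x) && (y != u x))
  (polytime_tree_path_from pin (polytime_root _ _) pu)).
have py := polytime_var i (enc_v h); have pu' := polytime_weak (enc_v h) pu.
apply: polytime_andb.
  exact: (polytime_same_cluster (h := fun y => h (projT1 y)) (polytime_weak _ pin) py pu').
apply: polytime_negb.
exact: (polytime_vertex_eq (n := fun y => input_order (h (projT1 y))) py pu').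
Qed.

Lemma polytime_portal_list X (i : X -> data) (h : X -> tree_input) :
  polytime i (fun x => enc_input (h x)) ->
  polytime i (fun x => enc_seq (@enc_vertex (input_order (h x))) (portal_list (inst h x))).
Proof.
move=> pin.
apply: (polytime_filter (p := fun x p => p \in portals (inst h x)) (polytime_vertices pin)).
have pP : polytime i (fun x => enc_set (portals (inst h x))).
  exact: polytime_tl (polytime_tl (polytime_tl pin)).
exact: (polytime_mem_set (h := fun y => h (projT1 y))
  (A := fun y => portals (inst h (projT1 y))) (polytime_weak _ pP) (polytime_var _ _)).
Qed.

Section Quantified.
Variables (X : Type) (i : X -> data) (h : X -> tree_input) (u : forall x, vertex h x).
Hypothesis pin : polytime i (fun x => enc_input (h x)).
Hypothesis pu : polytime i (fun x => enc_vertex (u x)).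

(** The contexts [j] and [k] add one and two bound portals; the suffixes [j] and [k] mark data
    transported to these contexts. *)
Let j := ext i (enc_v h).
Let k := ext j (fun y => @enc_vertex (input_order (h (projT1 y)))).
Let hj (y : {x : X & vertex h x}) := h (projT1 y).
Let hk (y : {y : {x : X & vertex h x} & vertex h (projT1 y)}) := h (projT1 (projT1 y)).
Let uj (y : {x : X & vertex h x}) : vertex hj y := u (projT1 y).
Let uk (y : {y : {x : X & vertex h x} & vertex h (projT1 y)}) : vertex hk y :=
  u (projT1 (projT1 y)).
Let pj (y : {x : X & vertex h x}) : vertex hj y := projT2 y.
Let pk (y : {y : {x : X & vertex h x} & vertex h (projT1 y)}) : vertex hk y :=
  projT2 (projT1 y).
Let qk (y : {y : {x : X & vertex h x} & vertex h (projT1 y)}) : vertex hk y := projT2 y.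

Let pinj : polytime j (fun y => enc_input (hj y)). Proof. exact: polytime_weak pin. Qed.
Let pink : polytime k (fun y => enc_input (hk y)). Proof. exact: polytime_weak pinj. Qed.
Let puj : polytime j (fun y => enc_vertex (uj y)). Proof. exact: polytime_weak pu. Qed.
Let puk : polytime k (fun y => enc_vertex (uk y)). Proof. exact: polytime_weak puj. Qed.
Let ppj : polytime j (fun y => enc_vertex (pj y)). Proof. exact: polytime_var. Qed.
Let ppk : polytime k (fun y => enc_vertex (pk y)). Proof. exact: polytime_weak ppj. Qed.
Let pqk : polytime k (fun y => enc_vertex (qk y)). Proof. exact: polytime_var. Qed.

Lemma polytime_good_top :
  polytime i (fun x => enc_bool (good_top (inst h x) (input_root (h x)) (u x))).
Proof.
apply: polytime_andb (polytime_is_top pin pu) _.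
pose a x p q := tree_dist (graph (inst h x)) (u x) p <=
  tree_dist (graph (inst h x)) (u x) q + (Delta (inst h x) + Delta (inst h x)).
apply: (polytime_has (p := fun x p => below (inst h x) (input_root (h x)) (u x) p &&
  all (a x p) (portal_list (inst h x))) (polytime_portal_list pin)).
apply: polytime_andb (polytime_below pinj puj ppj) _.
apply: (polytime_all (p := fun y q => a (projT1 y) (projT2 y) q) (polytime_portal_list pinj)).
exact: (polytime_le_dist_slack (h := hk) pink puk ppk pqk).
Qed.

Lemma polytime_nearest_below : polytime i
  (fun x => enc_seq (@enc_vertex (input_order (h x)))
    (nearest_below (inst h x) (input_root (h x)) (u x))).
Proof.
pose a x p q := below (inst h x) (input_root (h x)) (u x) q ==>
  (tree_dist (graph (inst h x)) (u x) p <= tree_dist (graph (inst h x)) (u x) q).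
apply: (polytime_filter (p := fun x p => below (inst h x) (input_root (h x)) (u x) p &&
  all (a x p) (portal_list (inst h x))) (polytime_portal_list pin)).
apply: polytime_andb (polytime_below pinj puj ppj) _.
apply: (polytime_all (p := fun y q => a (projT1 y) (projT2 y) q) (polytime_portal_list pinj)).
apply: polytime_implb; first exact: (polytime_below pink puk pqk).
exact: (polytime_le_dist (h := hk) pink puk ppk pqk).
Qed.

End Quantified.

Lemma polytime_home_top X (i : X -> data) (h : X -> tree_input) (u : forall x, vertex h x) :
  polytime i (fun x => enc_input (h x)) -> polytime i (fun x => enc_vertex (u x)) ->
  polytime i (fun x => enc_vertex (home_top (inst h x) (input_root (h x)) (u x))).
Proof.
move=> pin pu; apply: (polytime_last (eB := enc_v h)); last exact: polytime_root.
apply: (polytime_filter (p := fun x y => good_top (inst h x) (input_root (h x)) y)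
  (polytime_tree_path_from pin (polytime_root _ _) pu)).
exact: (polytime_good_top (h := fun y => h (projT1 y)) (u := fun y => projT2 y)
  (polytime_weak _ pin) (polytime_var _ _)).
Qed.

Lemma polytime_vertex_portal X (i : X -> data) (h : X -> tree_input) (u : forall x, vertex h x) :
  polytime i (fun x => enc_input (h x)) -> polytime i (fun x => enc_vertex (u x)) ->
  polytime i (fun x => enc_vertex (vertex_portal (inst h x) (input_root (h x)) (u x))).
Proof.
move=> pin pu.
exact: (polytime_head (polytime_nearest_below pin (polytime_home_top pin pu)) (polytime_root _ _)).
Qed.

Lemma polytime_tree_solution : polytime enc_input
  (fun t => enc_assignment (input_instance t) (tree_solution (input_instance t) (input_root t))).
Proof.
have pin := polytime_id enc_input.
pose h (t : tree_input) := t.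
have pC := polytime_clusters (h := h) pin.
pose hj (y : {t : tree_input & {set 'I_(input_order t)}}) := projT1 y.
have pinj := polytime_weak (fun t => @enc_set (input_order t)) pin.
pose s (y : {t : tree_input & {set 'I_(input_order t)}}) :=
  [seq v <- enum 'I_(input_order (projT1 y)) | v \in projT2 y].
have ps : polytime (ext enc_input (fun t => @enc_set (input_order t)))
    (fun y => enc_seq (@enc_vertex (input_order (projT1 y))) (s y)).
  apply: (polytime_filter (p := fun y v => v \in projT2 y) (polytime_vertices (h := hj) pinj)).
  exact: (polytime_mem_set (h := fun y => hj (projT1 y)) (A := fun y => projT2 (projT1 y))
    (v := fun y => projT2 y) (polytime_weak _ (polytime_var _ _)) (polytime_var _ _)).
have pv := polytime_vertex_portal (h := hj) pinj (polytime_head ps (polytime_root _ hj)).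
have := polytime_map (C := fun=> nat) (eC := fun=> enc_nat)
  (h := fun t C => val (tree_solution (input_instance t) (input_root t) C)) pC
  (polytime_nat_of_unary pv).
by apply: polytime_eq => t; rewrite enc_seq_map.
Qed.

Lemma computes_of_polytime X (i o : X -> data) : polytime i o ->
  exists (P : program) (c k : nat), forall x, exists2 t,
    computes_in P (i x) (o x) t & (t <= c * data_size (i x) ^ k)%N.
Proof.
case=> P [e [g [re [c gc] _]]].
(* The term becomes function 0, so all calls shift by one. The constant comes from
   [(s + 1) ^ c <= 2 ^ c * s ^ c] for [s >= 1], plus two steps for the initial call. *)
exists (shift 1 e :: map (shift 1) P), (2 ^ c + 2)%N, c => x.
have [m le ev] := re x; exists (1 + m).+1.
  have := eval_reloc [:: shift 1 e] [::] ev; rewrite cats0 => ev'.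
  by apply: (EvalCall (EvalArg _ (i x)) _ ev').
have s1 := sz_gt0 (i x).
apply: (@leq_trans ((sz (i x)).+1 ^ c + 2)); first by have := gc x; lia.
rewrite mulnDl leq_add //; last by rewrite leq_pmulr // expn_gt0 s1.
by rewrite -expnMn; case: (c) => // c'; rewrite leq_exp2r //; lia.
Qed.

Theorem theorem5p5 :
  (forall (R : realFieldType) (V : finType) (I : instance R V),
     is_tree (graph I) -> portals I != set0 ->
     exists f : {set V} -> V, is_solution I 4%:R f)
  /\
  solvable_in_polynomial_time 4%:R
    (fun (n : nat) (I : instance rat 'I_n) =>
       is_tree (graph I) /\ portals I != set0).
Proof.
split=> [R V I tG P0|].
  have [r _] := set0Pn _ P0.
  by exists (tree_solution I r); apply: tree_solution_correct.
have [P [c [k H]]] := computes_of_polytime polytime_tree_solution.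
exists P, c, k => n I [tG P0].
(* A portal is a vertex, so vertex 0 exists and can serve as the root. *)
have n0 : (0 < n)%N by have [r _] := set0Pn _ P0; apply: leq_ltn_trans (ltn_ord r).
have [t run le] := H (@TreeInput n I (Ordinal n0) erefl tG P0).
exists (tree_solution I (Ordinal n0)), t; split=> //.
exact: tree_solution_correct.
Qed.
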